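(* Let $m,p\in\mathbb{N}$ with $p\ge2$. Suppose that $f(z)=h(z)+\overline{g(z)}=\sum_{k=0}^{\infty}a_kz^{pk+m}+\sum_{k=0}^{\infty}\overline{b_kz^{pk+m}}$ is harmonic and $p$-symmetric in $\mathbb{D}$ such that $|h'(0)|=|g'(0)|$ and $|g'(z)|\le|h'(z)|$ in $\mathbb{D}\setminus\{0\}$, where $h$ is bounded. Put $B_H(f,r)=\sum_{k=0}^{\infty}(|a_k|+|b_k|)r^{pk+m}$. Then the following hold. (1) If $\frac pm>\log_23$, then $B_H(f,r)\le\max\{\|h\|_\infty,\|g\|_\infty\}$ for $r\le\sqrt[m]{1/2}$. The extremal function is given by $f(z)=z^m+\overline{\lambda z^m}$, $|\lambda|=1$. (2) If $1\le\frac pm\le\log_23$, then $B_H(f,r)\le\max\{\|h\|_\infty,\|g\|_\infty\}$ for $r\le r_{p,m}$, where $r_{p,m}$ is the maximal positive root in $(0,1)$ of the equation $$-12r^{p-m}+r^{2(p-m)}+32r^{2p}+4=0.$$ The extremal function is given by $f(z)=h(z)+\overline{\lambda h(z)}$, $|\lambda|=1$, where $$h(z)=z^m\left(\frac{z^p-a}{1-az^p}\right)\quad\text{with}\quad a=\left(1-\frac{\sqrt{1-r_{p,m}^{2p}}}{\sqrt2}\right)\frac1{r_{p,m}^p}.$$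
   Context: $\mathbb{D}=\{z\in\mathbb{C}:|z|<1\}$, $\mathbb N=\{1,2,\dots\}$, $r\in[0,1)$ throughout, and $\|h\|_\infty=\sup_{z\in\mathbb{D}}|h(z)|$ (similarly for $g$). The functions $h(z)=\sum_{k\ge0}a_kz^{pk+m}$ and $g(z)=\sum_{k\ge0}b_kz^{pk+m}$ are analytic in $\mathbb{D}$. A harmonic function $f=h+\overline{g}$ in $\mathbb{D}$ ($h,g$ analytic) is called $p$-symmetric if $h$ and $g$ have power series of the form $\sum_{n\ge0}a_nz^{pn+m}$ and $\sum_{n\ge0}b_nz^{pn+m}$ for some nonnegative integer $m$. ''Extremal'' means that this $f$ shows that the stated radius cannot be enlarged: $B_H(f,r)=\max\{\|h\|_\infty,\|g\|_\infty\}$ when $r$ equals the stated radius, and $B_H(f,r)>\max\{\|h\|_\infty,\|g\|_\infty\}$ for larger $r\in(0,1)$. *)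

(* Defs.v *)
From HB Require Import structures.
From mathcomp Require Import all_boot all_order all_algebra.
From mathcomp Require Import complex.
From mathcomp Require Import all_classical all_reals all_analysis.
Set Implicit Arguments.
Unset Strict Implicit.
Unset Printing Implicit Defensive.
Import Order.TTheory GRing.Theory Num.Theory.
Import numFieldNormedType.Exports.
Local Open Scope classical_set_scope.
Local Open Scope complex_scope.
Local Open Scope ring_scope.

(* The norm [`|z|] of [R[i]] takes its values in [R[i]]; [normc] is the same
   modulus with values in [R]. *)
Notation normc := ComplexField.Normc.normc.

Section Definitions.
Variable R : realType.
Implicit Types (p m : nat) (f h g : R[i] -> R[i]) (a b : nat -> R[i]) (r : R).

Definition unit_disc : set R[i] := [set z | normc z < 1].

(* The topology used on the complex plane is that of [R[i]^o], the numeric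
   field [R[i]] seen as a normed module over itself; differentiability over
   this field is complex differentiability. *)
Definition cderivable h (z : R[i]) : Prop :=
  derivable (h : R[i]^o -> R[i]^o) z 1.

Definition cderive h (z : R[i]) : R[i] :=
  derive1 (h : R[i]^o -> R[i]^o) z.

Definition csums_to (u : nat -> R[i]) (l : R[i]) : Prop :=
  series (u : nat -> R[i]^o) @ \oo --> (l : R[i]^o).

Definition analytic_in_disc h : Prop :=
  forall z, unit_disc z -> cderivable h z.

Definition power_series_in_disc p m a h : Prop :=
  forall z, unit_disc z -> csums_to (fun k => a k * z ^+ (p * k + m)) (h z).

Definition bounded_in_disc h : Prop :=
  exists M : R, forall z, unit_disc z -> normc (h z) <= M.

(* Extended-real valued: it is [+oo] when [h] is unbounded in the disc, which
   can happen for the co-analytic part [g] below. *)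
Definition supnorm h : \bar R :=
  ereal_sup [set (normc (h z))%:E | z in unit_disc].

(* [f] is the harmonic function with analytic part [h] and co-analytic part
   [g] (so [b] holds the coefficients of [g], before conjugation); only the
   values in the unit disc matter. *)
Record p_symmetric p m f h g a b : Prop := PSymmetric {
  psym_decomp : forall z, unit_disc z -> f z = h z + (g z)^*%C ;
  psym_analytic_h : analytic_in_disc h ;
  psym_analytic_g : analytic_in_disc g ;
  psym_series_h : power_series_in_disc p m a h ;
  psym_series_g : power_series_in_disc p m b g }.

Record admissible p m f h g a b : Prop := Admissible {
  adm_sym : p_symmetric p m f h g a b ;
  adm_deriv0 : normc (cderive h 0) = normc (cderive g 0) ;
  adm_deriv : forall z, unit_disc z -> z <> 0 ->
    normc (cderive g z) <= normc (cderive h z) ;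
  adm_bounded : bounded_in_disc h }.

Definition B_H p m a b r : \bar R :=
  (\sum_(0 <= k <oo)
     ((normc (a k) + normc (b k)) * r ^+ (p * k + m))%:E)%E.

(* [f] belongs to the class and shows that the radius [r0] cannot be enlarged. *)
Definition extremal p m f h g (r0 : R) : Prop :=
  exists a b,
    [/\ admissible p m f h g a b,
        B_H p m a b r0 = maxe (supnorm h) (supnorm g)
      & forall r, r0 < r -> r < 1 ->
          (maxe (supnorm h) (supnorm g) < B_H p m a b r)%E].

(* The natural subtraction [p - m] is only used when [m <= p]. *)
Definition radius_root p m r : Prop :=
  - 12 * r ^+ (p - m) + r ^+ (2 * (p - m)) + 32 * r ^+ (2 * p) + 4 = 0.

Definition maximal_radius_root p m r : Prop :=
  [/\ 0 < r < 1, radius_root p m r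
    & forall s, 0 < s < 1 -> radius_root p m s -> s <= r].

Definition extremal_param p r : R :=
  (1 - Num.sqrt (1 - r ^+ (2 * p)) / Num.sqrt 2) * (r ^+ p)^-1.

Definition extremal_h p m r (z : R[i]) : R[i] :=
  let a := (extremal_param p r)%:C in
  z ^+ m * ((z ^+ p - a) / (1 - a * z ^+ p)).

End Definitions.

(* Main.v *)
Require Import Defs.
From HB Require Import structures.
From mathcomp Require Import all_boot all_order all_algebra.
From mathcomp Require Import complex.
From mathcomp Require Import all_classical all_reals all_analysis.
From mathcomp Require Import ring lra zify.
Set Implicit Arguments.
Unset Strict Implicit.
Unset Printing Implicit Defensive.
Import Order.TTheory GRing.Theory Num.Theory.
Import numFieldNormedType.Exports.
Local Open Scope classical_set_scope.
Local Open Scope complex_scope.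
Local Open Scope ring_scope.
Local Notation Re := complex.Re.
Local Notation Im := complex.Im.

(** Write [h z = z^m A(z^p)] and [z h'(z) = z^m H(z^p)], where [A] has coefficients
    [a_k] and [H] has coefficients [(pk + m) a_k], and let [G] be the analogue of [H]
    for [g], so that [|G| <= |H|] on the disc.  Then [G = omega H] formally with
    [|omega| <= 1], which is used only through coefficient inequalities: Schwarz's
    lemma for quotients of power series drives the Schur algorithm, and this gives
    Rogosinski's inequality [sum_(k < n) |G_k|^2 <= sum_(k < n) |H_k|^2] as well as
    [|omega_k| <= 1 - |omega_0|^2].

    With [rho = r^p] and [|h| <= 1], the sum [sum_k |a_k| rho^k] is at most
    [t + rho (1 - t^2) / (1 - rho t)], [t = |a_0|], when [t >= rho].  If [t >= 2/3]
    the coefficients of [g] have a smaller majorant sum than those of [h], because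
    the weights [(pj + m) / (pk + m)] in [b_k = sum_j omega_(k-j) a_j (pj+m)/(pk+m)]
    compensate for [rho > 1/3]; if [t <= 2/3] Cauchy-Schwarz is enough for both
    series.  Maximising over [t] produces the equation of the radius, and the
    maximiser is the parameter of the extremal Blaschke factor. *)

(** * Power series in the unit disc *)

(** Statements about it are put in the homogeneous form [|u| <= |v|], numerator and denominator
    being separate series; a zero of the denominator is moved outside a circle, and a Parseval sum
    limits how often this can happen.

    Without weights, [|omega_k| <= 1 - |omega_0|^2] compares the majorants of [g] and [h] only for
    [rho <= 1/3]. At [r^m = 1/2] one has [rho < 1/3] exactly when [p/m > log_2 3], which separates
    the two cases. In case (2) [rho] runs from 1/3 to [sqrt(7/32)], its value for [p = m], and
    117/250 is this number rounded up. For [m <= p] the weights are at most [(j + 1) / (k + 1)],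
    their value at [p = m], so the numerical estimates are uniform in [p] and [m]. Only the estimate
    of [h] for large [t] has to be sharp; the split at 2/3 and the constants around it leave some
    room. *)

Section Modulus.
Variable R : realType.
Implicit Types x y z : R[i].

Lemma normC_normc z : `|z| = (normc z)%:C.
Proof. by case: z. Qed.

Lemma normc_ge0 z : 0 <= normc z.
Proof. by case: z => a b; exact: sqrtr_ge0. Qed.

Lemma normc_0 : normc (0 : R[i]) = 0.
Proof. exact: ComplexField.Normc.normc0. Qed.

Lemma normc_1 : normc (1 : R[i]) = 1.
Proof. exact: ComplexField.Normc.normc1. Qed.

Lemma normcM x y : normc (x * y) = normc x * normc y.
Proof. exact: ComplexField.Normc.normcM. Qed.

Lemma normcX x n : normc (x ^+ n) = normc x ^+ n.
Proof. by elim: n => [|n IH]; rewrite ?normc_1 // !exprS normcM IH. Qed.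

Lemma normcV x : normc x^-1 = (normc x)^-1.
Proof. exact: ComplexField.Normc.normcV. Qed.

Lemma normc_opp x : normc (- x) = normc x.
Proof. by case: x => a b /=; rewrite !sqrrN. Qed.

Lemma normcB x y : normc (x - y) = normc (y - x).
Proof. by rewrite -normc_opp opprB. Qed.

Lemma normc_triangle x y : normc (x + y) <= normc x + normc y.
Proof. exact: le_normcD. Qed.

Lemma normc_triangleB x y : normc (x - y) <= normc x + normc y.
Proof. by rewrite -[normc y]normc_opp; exact: normc_triangle. Qed.

Lemma normc_sum n (u : nat -> R[i]) :
  normc (\sum_(k < n) u k) <= \sum_(k < n) normc (u k).
Proof.
elim: n => [|n IH]; first by rewrite !big_ord0 normc_0.
rewrite !big_ord_recr /=; apply: (le_trans (normc_triangle _ _)).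
by rewrite lerD2r.
Qed.

Lemma normc_eq0 x : (normc x == 0) = (x == 0).
Proof.
apply/eqP/eqP => [|->]; last exact: normc_0.
exact: ComplexField.Normc.eq0_normc.
Qed.

Lemma normc_gt0 x : (0 < normc x) = (x != 0).
Proof. by rewrite lt_def normc_eq0 normc_ge0 andbT. Qed.

Lemma normc_real (a : R) : normc a%:C = `|a|.
Proof. by rewrite /= expr0n addr0 sqrtr_sqr. Qed.

Lemma normc_conj x : normc x^*%C = normc x.
Proof. by case: x => a b /=; rewrite sqrrN. Qed.

Lemma normc_sqr x : normc x ^+ 2 = (Re x) ^+ 2 + (Im x) ^+ 2.
Proof. by case: x => a b /=; rewrite sqr_sqrtr // addr_ge0 // sqr_ge0. Qed.

Lemma Re_le_normc x : `|Re x| <= normc x.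
Proof.
rewrite -(@ler_pXn2r _ 2) ?nnegrE ?normr_ge0 ?normc_ge0 //.
by rewrite normc_sqr real_normK ?num_real // lerDl sqr_ge0.
Qed.

Lemma Im_le_normc x : `|Im x| <= normc x.
Proof.
rewrite -(@ler_pXn2r _ 2) ?nnegrE ?normr_ge0 ?normc_ge0 //.
by rewrite normc_sqr real_normK ?num_real // lerDr sqr_ge0.
Qed.

Lemma normc_le_ReIm x : normc x <= `|Re x| + `|Im x|.
Proof.
rewrite -(@ler_pXn2r _ 2) ?nnegrE ?addr_ge0 ?normr_ge0 ?normc_ge0 //.
rewrite normc_sqr sqrrD !real_normK ?num_real //.
have : 0 <= `|Re x| * `|Im x| by rewrite mulr_ge0.
lra.
Qed.

Lemma normc_sqr_conj x : (normc x ^+ 2)%:C = x * x^*%C.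
Proof.
case: x => a b; rewrite normc_sqr /=; apply/eqP; rewrite eq_complex /=.
by apply/andP; split; apply/eqP; ring.
Qed.

End Modulus.

Opaque ComplexField.Normc.normc.

Section ComplexSeries.
Variable R : realType.
Implicit Types (u v : nat -> R[i]) (z w : R[i]) (x y M q : R).

(** Convergence is expressed by the real modulus, so that squeezing and order arguments take place
    in [R]; [ctendsP] identifies it with convergence in [R[i]^o]. *)
Definition ctends u z := (fun n => normc (u n - z)) @ \oo --> (0 : R).

Lemma ctends_squeeze u z (e : nat -> R) :
  (forall n, normc (u n - z) <= e n) -> e @ \oo --> (0 : R) -> ctends u z.
Proof.
move=> ue e0; apply: (@squeeze_cvgr _ _ _ _ (fun=> 0) e) => //.
- by near=> n; rewrite normc_ge0 ue.
- exact: cvg_cst.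
Unshelve. all: end_near. Qed.

Lemma ctendsD u v z w : ctends u z -> ctends v w ->
  ctends (fun n => u n + v n) (z + w).
Proof.
move=> uz vw; apply: (@ctends_squeeze _ _ (fun n => normc (u n - z) + normc (v n - w))).
  by move=> n; rewrite opprD addrACA normc_triangle.
by rewrite -[X in _ --> X](addr0 0); apply: cvgD.
Qed.

Lemma ctendsM u v z w : ctends u z -> ctends v w ->
  ctends (fun n => u n * v n) (z * w).
Proof.
move=> uz vw; apply: (@ctends_squeeze _ _ (fun n => normc (u n - z) * normc (v n - w)
  + normc (u n - z) * normc w + normc z * normc (v n - w))).
  move=> n; rewrite -!normcM.
  have -> : u n * v n - z * w =
    (u n - z) * (v n - w) + (u n - z) * w + z * (v n - w) by ring.
  apply: (le_trans (normc_triangle _ _)); rewrite lerD2r.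
  exact: normc_triangle.
have -> : 0 = (0 : R) * 0 + 0 * normc w + normc z * 0 by ring.
apply: cvgD; last by apply: cvgMr.
by apply: cvgD; [exact: cvgM | apply: cvgMl].
Qed.

Lemma ctends_cst z : ctends (fun=> z) z.
Proof. by rewrite /ctends subrr normc_0; exact: cvg_cst. Qed.

Lemma ctends_unique u z w : ctends u z -> ctends u w -> z = w.
Proof.
move=> uz uw; apply/eqP; rewrite -subr_eq0 -normc_eq0; apply/eqP.
have : (fun n => normc (u n - z) + normc (u n - w)) @ \oo --> (0 : R).
  by rewrite -[X in _ --> X](addr0 0); apply: cvgD.
move=> h; apply/eqP; rewrite eq_le normc_ge0 andbT.
rewrite -(cvg_lim (@Rhausdorff R) h); apply: limr_ge.
  by apply/cvg_ex; exists 0.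
near=> n; rewrite [normc (u n - z)]normcB.
have -> : z - w = (z - u n) + (u n - w) by ring.
exact: normc_triangle.
Unshelve. all: end_near. Qed.

Lemma ctends_normc_le u z M : ctends u z -> (forall n, normc (u n) <= M) ->
  normc z <= M.
Proof.
move=> uz uM; have h : (fun n => normc (u n - z) + M) @ \oo --> M.
  by rewrite -[X in _ --> X]add0r; apply: cvgD => //; exact: cvg_cst.
rewrite -(cvg_lim (@Rhausdorff R) h); apply: limr_ge.
  by apply/cvg_ex; exists M.
near=> n; apply: le_trans (_ : normc (u n - z) + normc (u n) <= _); last by rewrite lerD2l.
by rewrite [normc (u n - z)]normcB -{1}[z](subrK (u n)) normc_triangle.
Unshelve. all: end_near. Qed.

Lemma ctends_shift u z : ctends (fun n => u n.+1) z -> ctends u z.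
Proof. by rewrite /ctends -[X in _ -> X]cvg_shiftS. Qed.

Lemma ctends_shiftS u z : ctends u z -> ctends (fun n => u n.+1) z.
Proof. by rewrite /ctends -[X in X -> _]cvg_shiftS. Qed.

Lemma geometric_sum_le q n : 0 <= q -> q < 1 ->
  \sum_(k < n) q ^+ k <= (1 - q)^-1.
Proof.
move=> q0 q1; rewrite -[leRHS]mul1r ler_pdivlMr ?subr_gt0 //.
suff -> : (\sum_(k < n) q ^+ k) * (1 - q) = 1 - q ^+ n.
  by rewrite gerBl exprn_ge0.
elim: n => [|n IH]; first by rewrite big_ord0 mul0r expr0 subrr.
by rewrite big_ord_recr /= mulrDl IH exprS; ring.
Qed.

Definition psum u z n := \sum_(k < n) u k * z ^+ k.

End ComplexSeries.

HB.lock Definition ev (R : realType) (u : nat -> R[i]) (z : R[i]) : R[i] :=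
  xget 0 [set l | ctends (psum u z) l].

Section PowerSeries.
Variable R : realType.
Implicit Types (u v : nat -> R[i]) (z w : R[i]) (x y M q : R).

(** Radius of convergence at least 1, in Abel's form: bounded terms survive shifts and division by a
    linear factor, and a slightly larger [x] recovers geometric decay. *)
Definition disc_series u := forall x, 0 <= x -> x < 1 ->
  exists M, forall k, normc (u k) * x ^+ k <= M.

Lemma geometric_series_cvg u M q : 0 <= q -> q < 1 ->
  (forall k, normc (u k) <= M * q ^+ k) ->
  exists l, ctends (fun n => \sum_(k < n) u k) l.
Proof.
move=> q0 q1 uM.
have cv (f : R[i] -> R) : (forall z, `|f z| <= normc z) ->
    cvgn (series (fun k => f (u k))).
  move=> fle; apply: normed_cvg.
  apply: (series_le_cvg (v_ := geometric M q)).
  - by move=> n; rewrite normr_ge0.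
  - by move=> n; rewrite /geometric /= (le_trans _ (uM n)) // normc_ge0.
  - by move=> n; rewrite /geometric /= (le_trans (fle _)).
  - by apply: is_cvg_geometric_series; rewrite ger0_norm.
have cR := cv _ (@Re_le_normc R); have cI := cv _ (@Im_le_normc R).
exists (Complex (limn (series (fun k => Re (u k)))) (limn (series (fun k => Im (u k))))).
apply: (@ctends_squeeze _ _ _ (fun n =>
  `|series (fun k => Re (u k)) n - limn (series (fun k => Re (u k)))| +
  `|series (fun k => Im (u k)) n - limn (series (fun k => Im (u k)))|)).
  move=> n; apply: (le_trans (normc_le_ReIm _)).
  have -> : \sum_(k < n) u k = Complex (series (fun k => Re (u k)) n)
     (series (fun k => Im (u k)) n).
    rewrite /series /= !big_mkord; elim: n => [|n IH]; first by rewrite !big_ord0.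
    by rewrite !big_ord_recr /= IH; case: (u n).
  by [].
rewrite -[X in _ --> X](addr0 0); apply: cvgD.
  rewrite -(normr0 R); apply: cvg_norm; apply/subr_cvg0; exact: cR.
rewrite -(normr0 R); apply: cvg_norm; apply/subr_cvg0; exact: cI.
Qed.

Lemma disc_series_bound u x : disc_series u -> 0 <= x -> x < 1 ->
  exists M q, [/\ 0 <= M, 0 <= q, q < 1 &
    forall k, normc (u k) * x ^+ k <= M * q ^+ k].
Proof.
move=> us x0 x1; pose y := (x + 1) / 2.
have y0 : 0 < y by rewrite /y; lra.
have y1 : y < 1 by rewrite /y; lra.
have [M HM] := us y (ltW y0) y1.
exists M, (x / y); split.
- by have := HM 0; rewrite expr0 mulr1; apply: le_trans; exact: normc_ge0.
- by rewrite divr_ge0 // ltW.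
- by rewrite ltr_pdivrMr // mul1r /y; lra.
move=> k; rewrite expr_div_n mulrA ler_pdivlMr ?exprn_gt0 //.
by rewrite mulrAC ler_wpM2r // exprn_ge0.
Qed.

Lemma evP u z : disc_series u -> normc z < 1 -> ctends (psum u z) (ev u z).
Proof.
move=> us z1.
have [M [q [M0 q0 q1 HM]]] := disc_series_bound us (normc_ge0 z) z1.
have [l Hl] : exists l, ctends (psum u z) l.
  apply: (@geometric_series_cvg (fun k => u k * z ^+ k) M q) => // k.
  by rewrite normcM normcX.
rewrite ev.unlock; case: xgetP => [l' -> //|/(_ l)]; by [].
Qed.

Lemma ev_unique u z l : disc_series u -> normc z < 1 ->
  ctends (psum u z) l -> ev u z = l.
Proof. by move=> us z1 h; apply: ctends_unique h; apply: evP. Qed.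

Lemma ev_bound u z M q : disc_series u -> normc z < 1 -> 0 <= M -> 0 <= q -> q < 1 ->
  (forall k, normc (u k) * normc z ^+ k <= M * q ^+ k) ->
  normc (ev u z) <= M / (1 - q).
Proof.
move=> us z1 M0 q0 q1 H; apply: (ctends_normc_le (evP us z1)) => n.
apply: (le_trans (normc_sum _ (fun k => u k * z ^+ k))).
apply: (@le_trans _ _ (\sum_(k < n) M * q ^+ k)).
  by apply: ler_sum => k _; rewrite normcM normcX.
by rewrite -mulr_sumr ler_wpM2l // geometric_sum_le.
Qed.

Lemma ev_bounded u x : disc_series u -> 0 <= x -> x < 1 ->
  exists2 M, 0 <= M & forall z, normc z <= x -> normc (ev u z) <= M.
Proof.
move=> us x0 x1; have [M [q [M0 q0 q1 HM]]] := disc_series_bound us x0 x1.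
exists (M / (1 - q)); first by rewrite divr_ge0 // subr_ge0 ltW.
move=> z zx; apply: ev_bound => //; first exact: le_lt_trans x1.
move=> k; apply: le_trans (HM k); apply: ler_wpM2l; first exact: normc_ge0.
by rewrite lerXn2r // nnegrE ?normc_ge0.
Qed.

Lemma disc_seriesD u v : disc_series u -> disc_series v ->
  disc_series (fun k => u k + v k).
Proof.
move=> us vs x x0 x1; have [M HM] := us x x0 x1; have [N HN] := vs x x0 x1.
exists (M + N) => k; apply: le_trans (lerD (HM k) (HN k)).
by rewrite -mulrDl ler_wpM2r ?exprn_ge0 // normc_triangle.
Qed.

Lemma disc_seriesZ c u : disc_series u -> disc_series (fun k => c * u k).
Proof.
move=> us x x0 x1; have [M HM] := us x x0 x1.
exists (normc c * M) => k; rewrite normcM -mulrA ler_wpM2l ?normc_ge0 //.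
Qed.

Lemma disc_series_shift u : disc_series u -> disc_series (fun k => u k.+1).
Proof.
move=> us x x0 x1.
have [y [xy y0 y1]] : exists y, [/\ x <= y, 0 < y & y < 1].
  by exists ((x + 1) / 2); split; lra.
have [M HM] := us y (ltW y0) y1; exists (M / y) => k; rewrite ler_pdivlMr //.
apply: le_trans (HM k.+1); rewrite exprS -mulrA ler_wpM2l ?normc_ge0 //.
by rewrite mulrC ler_wpM2l ?(ltW y0) // lerXn2r // ?nnegrE // ltW.
Qed.

Definition cons_series c u : nat -> R[i] := fun k => if k is k'.+1 then u k' else c.

Lemma disc_series_cons c u : disc_series u -> disc_series (cons_series c u).
Proof.
move=> us x x0 x1; have [M HM] := us x x0 x1.
exists (normc c + M); case => [|k] /=.
  rewrite expr0 mulr1 lerDl; have := HM 0; apply: le_trans.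
  by rewrite expr0 mulr1 normc_ge0.
apply: le_trans (_ : M <= _); last by rewrite lerDr normc_ge0.
apply: le_trans (HM k); rewrite ler_wpM2l ?normc_ge0 // exprS ler_piMl //.
  exact: exprn_ge0.
exact: ltW.
Qed.

Lemma evD u v z : disc_series u -> disc_series v -> normc z < 1 ->
  ev (fun k => u k + v k) z = ev u z + ev v z.
Proof.
move=> us vs z1; apply: ev_unique => //; first exact: disc_seriesD.
have := ctendsD (evP us z1) (evP vs z1); congr (ctends _ _).
apply/funext => n; rewrite /psum -big_split /=; apply: eq_bigr => k _.
by rewrite mulrDl.
Qed.

Lemma evZ c u z : disc_series u -> normc z < 1 ->
  ev (fun k => c * u k) z = c * ev u z.
Proof.
move=> us z1; apply: ev_unique => //; first exact: disc_seriesZ.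
have := ctendsM (ctends_cst c) (evP us z1); congr (ctends _ _).
apply/funext => n; rewrite /psum mulr_sumr /=; apply: eq_bigr => k _.
by rewrite mulrA.
Qed.

Lemma ev_cons c u z : disc_series u -> normc z < 1 ->
  ev (cons_series c u) z = c + z * ev u z.
Proof.
move=> us z1; apply: ev_unique => //; first exact: disc_series_cons.
apply: ctends_shift.
have := ctendsD (ctends_cst c) (ctendsM (ctends_cst z) (evP us z1)).
congr (ctends _ _); apply/funext => n; rewrite /psum big_ord_recl /= expr0 mulr1.
congr (_ + _); rewrite mulr_sumr; apply: eq_bigr => k _.
by rewrite /bump /= add1n exprS; ring.
Qed.

Lemma ev_shift u z : disc_series u -> normc z < 1 ->
  ev u z = u 0%N + z * ev (fun k => u k.+1) z.
Proof.
move=> us z1; rewrite -ev_cons //; last exact: disc_series_shift.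
by congr ev; apply/funext; case.
Qed.

Lemma ev0 u : disc_series u -> ev u 0 = u 0%N.
Proof. by move=> us; rewrite ev_shift ?mul0r ?addr0 // normc_0. Qed.

Lemma disc_series_cst0 : disc_series (fun=> 0).
Proof. by move=> x _ _; exists 0 => k; rewrite normc_0 mul0r. Qed.

Lemma ev_cst0 z : normc z < 1 -> ev (fun=> 0) z = 0.
Proof.
move=> z1; apply: ev_unique => //; first exact: disc_series_cst0.
rewrite (_ : psum _ _ = fun=> 0); first exact: ctends_cst.
by apply/funext => n; rewrite /psum big1 // => k _; rewrite mul0r.
Qed.

End PowerSeries.

(** * Division by a linear factor and Blaschke flips *)

Section Division.
Variable R : realType.
Implicit Types (u v : nat -> R[i]) (z w : R[i]) (x y M q : R).

Lemma disc_series_drop n u : disc_series u -> disc_series (fun j => u (n + j)%N).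
Proof.
move=> us; elim: n => [|n IH] //.
have := disc_series_shift IH; congr disc_series.
by apply/funext => j; rewrite addnS addSn.
Qed.

(* The coefficients of [(ev u w - ev u z) / (w - z)] as a power series in [w]. *)
Definition divs z u : nat -> R[i] := fun k => ev (fun j => u (k.+1 + j)%N) z.

Lemma divs_rec z u k : disc_series u -> normc z < 1 ->
  divs z u k = u k.+1 + z * divs z u k.+1.
Proof.
move=> us z1; rewrite /divs ev_shift //; last exact: disc_series_drop.
by rewrite addn0; congr (_ + _ * ev _ z); apply/funext => j; rewrite addnS.
Qed.

Lemma divs0 z u : disc_series u -> normc z < 1 ->
  ev u z = u 0%N + z * divs z u 0%N.
Proof. by move=> us z1; rewrite ev_shift. Qed.

(** For [max(x, |z|) < y < 1] the tail of [u] that defines the k-th coefficient is geometric with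
    ratio [|z| / y], hence of order [y^-(k+1)]. *)
Lemma disc_series_divs z u : disc_series u -> normc z < 1 ->
  disc_series (divs z u).
Proof.
move=> us z1 x x0 x1.
have [y [xy zy y0 y1]] : exists y, [/\ x < y, normc z < y, 0 < y & y < 1].
  exists ((Num.max x (normc z) + 1) / 2).
  have : Num.max x (normc z) < 1 by rewrite gt_max x1.
  have : x <= Num.max x (normc z) by rewrite le_max lexx.
  have : normc z <= Num.max x (normc z) by rewrite le_max lexx orbT.
  by move=> *; split; lra.
have [M HM] := us y (ltW y0) y1.
have M0 : 0 <= M by have := HM 0%N; rewrite expr0 mulr1; apply: le_trans; exact: normc_ge0.
pose q := normc z / y.
have q0 : 0 <= q by rewrite divr_ge0 ?normc_ge0 // ltW.
have q1 : q < 1 by rewrite ltr_pdivrMr // mul1r.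
exists (M / y / (1 - q)) => k.
have yk : 0 < y ^+ k.+1 by rewrite exprn_gt0.
have H : normc (divs z u k) <= M / y ^+ k.+1 / (1 - q).
  apply: ev_bound => //; first exact: disc_series_drop.
    by rewrite divr_ge0 // ltW.
  move=> j; have := HM (k.+1 + j)%N; rewrite exprD mulrCA mulrC => h.
  rewrite /q expr_div_n mulrA ler_pdivlMr ?exprn_gt0 // mulrAC.
  by rewrite ler_wpM2r ?exprn_ge0 ?normc_ge0 // ler_pdivlMr.
apply: le_trans (_ : M / y ^+ k.+1 / (1 - q) * x ^+ k <= _).
  by rewrite ler_wpM2r // exprn_ge0.
rewrite mulrAC ler_wpM2r //; first by rewrite invr_ge0 subr_ge0 ltW.
have -> : M / y ^+ k.+1 * x ^+ k = M / y * (x ^+ k / y ^+ k).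
  by rewrite exprS invfM; ring.
rewrite ler_piMr ?divr_ge0 ?(ltW y0) // ler_pdivrMr ?exprn_gt0 // mul1r.
by rewrite lerXn2r ?nnegrE //; exact: ltW.
Qed.

Lemma ev_divs z w u : disc_series u -> normc z < 1 -> normc w < 1 ->
  ev u w = ev u z + (w - z) * ev (divs z u) w.
Proof.
move=> us z1 w1; have ds := disc_series_divs us z1.
have -> : ev u w = ev (fun k => cons_series (ev u z) (divs z u) k
   + (- z) * divs z u k) w.
  congr ev; apply/funext; case => [|k] /=.
    by rewrite [ev u z]divs0 // mulNr addrK.
  by rewrite [X in X + _]divs_rec // mulNr addrK.
rewrite evD //; [|exact: disc_series_cons|exact: disc_seriesZ].
by rewrite ev_cons // evZ // mulNr mulrBl addrA.
Qed.

Lemma ev_zero_divs z w u : disc_series u -> normc z < 1 -> normc w < 1 ->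
  ev u z = 0 -> ev u w = (w - z) * ev (divs z u) w.
Proof. by move=> us z1 w1 uz; rewrite (ev_divs us z1) // uz add0r. Qed.

Lemma ev_lipschitz u z : disc_series u -> normc z < 1 ->
  exists L d, [/\ 0 <= L, 0 < d & forall w, normc (w - z) < d ->
    normc w < 1 /\ normc (ev u w - ev u z) <= L * normc (w - z)].
Proof.
move=> us z1.
have t0 : 0 <= (1 + normc z) / 2 by move: (normc_ge0 z); lra.
have t1 : (1 + normc z) / 2 < 1 by lra.
have [L L0 HL] := ev_bounded (disc_series_divs us z1) t0 t1.
exists L, ((1 - normc z) / 2); split => //; first by lra.
move=> w wz; have wle : normc w <= (1 + normc z) / 2.
  have := normc_triangle (w - z) z; rewrite subrK; lra.
have w1 : normc w < 1 by lra.
split => //; rewrite (ev_divs us z1) // addrC addKr normcM mulrC.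
by rewrite ler_wpM2r ?normc_ge0 // HL.
Qed.

(** * Limits and continuity at a point of the complex plane *)

Definition ccvg (f : R[i] -> R[i]) z (l : R[i]) :=
  (f : R[i]^o -> R[i]^o) w @[w --> (z : R[i]^o)] --> (l : R[i]^o).

Lemma ccvg_lipschitz (f : R[i] -> R[i]) z (l : R[i]) L d : 0 <= L -> 0 < d ->
  (forall w, normc (w - z) < d -> normc (f w - l) <= L * normc (w - z)) ->
  ccvg f z l.
Proof.
move=> L0 d0 H; apply/(@cvgrPdist_lt _ (R[i]^o) (R[i]^o) (nbhs (z : R[i]^o)) _ f l).
move=> e; rewrite ltcE /= => /andP[/eqP e_im e0].
have [d' [d'0 d'd d'e]] : exists d', [/\ 0 < d', d' <= d & d' * (L + 1) <= Re e].
  exists (Num.min d (Re e / (L + 1))); split.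
  - by rewrite lt_min d0 divr_gt0 // ltr_wpDl.
  - by rewrite ge_min lexx.
  - by rewrite -ler_pdivlMr ?ltr_wpDl // ge_min lexx orbT.
apply/(@nbhs_normP _ (R[i]^o)). exists d'%:C => /=; first by rewrite ltcR.
move=> w /=; rewrite distrC normC_normc ltcR => wd.
rewrite distrC normC_normc ltcE /= e_im eqxx /=.
apply: le_lt_trans (H _ _) _; first exact: lt_le_trans d'd.
apply: lt_le_trans d'e.
have := normc_ge0 (w - z); nra.
Qed.

Lemma ccvg_epsilon (f : R[i] -> R[i]) z (l : R[i]) :
  ccvg f z l ->
  forall e, 0 < e -> exists2 d, 0 < d &
  forall w, normc (w - z) < d -> normc (f w - l) < e.
Proof.
move=> /(@cvgrPdist_lt _ (R[i]^o) (R[i]^o) (nbhs (z : R[i]^o)) _ f l) H e e0.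
have e0' : 0 < e%:C :> R[i] by rewrite ltcR.
have /(@nbhs_normP _ (R[i]^o))[d /=] := H _ e0'.
rewrite ltcE /= => /andP[/eqP d_im d0] Hd.
exists (Re d) => // w wd.
have := Hd w; rewrite /= distrC normC_normc ltcE /= d_im eqxx /= => /(_ wd).
by rewrite distrC normC_normc ltcR.
Qed.

Lemma ccvg_cst (a : R[i]) z : ccvg (fun=> a) z a.
Proof.
by apply: (@ccvg_lipschitz _ _ _ 1 1) => // w _; rewrite subrr normc_0 mul1r normc_ge0.
Qed.

Lemma ccvg_id z : ccvg id z z.
Proof.
by apply: (@ccvg_lipschitz _ _ _ 1 1) => // w _; rewrite mul1r.
Qed.

Lemma ccvgD (f g : R[i] -> R[i]) z (a b : R[i]) : ccvg f z a -> ccvg g z b ->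
  ccvg (fun w => f w + g w) z (a + b).
Proof.
move=> fa gb; exact: (@cvgD R[i] R[i]^o R[i]^o (nbhs (z : R[i]^o)) _ f g a b fa gb).
Qed.

Lemma ccvgB (f g : R[i] -> R[i]) z (a b : R[i]) : ccvg f z a -> ccvg g z b ->
  ccvg (fun w => f w - g w) z (a - b).
Proof.
move=> fa gb; exact: (@cvgB R[i] R[i]^o R[i]^o (nbhs (z : R[i]^o)) _ f g a b fa gb).
Qed.

Lemma ccvgM (f g : R[i] -> R[i]) z (a b : R[i]) : ccvg f z a -> ccvg g z b ->
  ccvg (fun w => f w * g w) z (a * b).
Proof.
move=> fa gb; exact: (@cvgM R[i] R[i]^o (nbhs (z : R[i]^o)) _ f g a b fa gb).
Qed.

Lemma ccvgV (f : R[i] -> R[i]) z (a : R[i]) : a != 0 -> ccvg f z a ->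
  ccvg (fun w => (f w)^-1) z a^-1.
Proof.
move=> a0 fa; exact: (@cvgV R[i] R[i]^o (nbhs (z : R[i]^o)) _ f a a0 fa).
Qed.

Lemma ccvgX (f : R[i] -> R[i]) z (a : R[i]) n : ccvg f z a ->
  ccvg (fun w => f w ^+ n) z (a ^+ n).
Proof.
move=> fa; elim: n => [|n IH]; first exact: ccvg_cst.
rewrite (_ : (fun w => _) = fun w => f w * f w ^+ n); last first.
  by apply/funext => w; rewrite exprS.
by rewrite exprS; exact: ccvgM.
Qed.

Lemma ev_continuous u z : disc_series u -> normc z < 1 ->
  ccvg (ev u) z (ev u z).
Proof.
move=> us z1; have [L [d [L0 d0 H]]] := ev_lipschitz us z1.
by apply: (@ccvg_lipschitz _ _ _ L d) => // w /H[].
Qed.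

(** Continuity restores an inequality at the one point lost when a common linear factor is
    cancelled. *)
Lemma ev_dominated_at u v z : disc_series u -> disc_series v -> normc z < 1 ->
  (forall w, normc w < 1 -> w != z -> normc (ev u w) <= normc (ev v w)) ->
  normc (ev u z) <= normc (ev v z).
Proof.
have aux (a b c d f g e : R) : d < e / 2 -> c < e / 2 -> b <= f -> f <= d + g ->
  a <= b + c -> a <= g + e by lra.
move=> us vs z1 H; apply/ler_addgt0Pr => e e0.
have e2 : 0 < e / 2 by lra.
have [L [d0 [_ d0p /= Hd0]]] := ev_lipschitz us z1.
have [d1 d1p Hd1] := ccvg_epsilon (ev_continuous us z1) e2.
have [d2 d2p Hd2] := ccvg_epsilon (ev_continuous vs z1) e2.
pose d := Num.min (Num.min d0 d1) d2 / 2.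
have dp : 0 < Num.min (Num.min d0 d1) d2 by rewrite !lt_min d0p d1p.
have d'p : 0 < d by rewrite /d; lra.
have dlt : d < Num.min (Num.min d0 d1) d2 by rewrite /d; lra.
move: dlt; rewrite !lt_min => /andP[/andP[dd0 dd1] dd2].
pose w := z + d%:C.
have wz : normc (w - z) = d by rewrite /w addrC addKr normc_real gtr0_norm.
have wne : w != z.
  by apply/eqP => E; move: wz; rewrite E subrr normc_0 => E'; move: d'p; rewrite -E' ltxx.
have [w1 _] := Hd0 w ltac:(by rewrite wz).
apply: aux (Hd2 w _) (Hd1 w _) (H w w1 wne) _ _; rewrite ?wz //.
  by rewrite -[X in normc X <= _](subrK (ev v z)); exact: normc_triangle.
by have := normc_triangleB (ev u w) (ev u w - ev u z); rewrite opprB addrC subrK.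
Qed.

End Division.
Arguments ccvg_cst {R} a z [t].
Arguments ccvg_id {R} z [t].
Arguments ccvgX {R f z a} n _ [t].

(** * Moving a zero across a circle *)

Section Flip.
Variable R : realType.
Implicit Types (u v : nat -> R[i]) (z w : R[i]) (x y M q : R).

(* Replaces a factor [w - z] of [u] by [y - conj z * w / y], which has the same
   modulus on the circle of radius [y], as a Blaschke factor does. *)
Definition flip y z u : nat -> R[i] := fun k =>
  y%:C * divs z u k + cons_series 0 (fun j => - (z^*%C / y%:C) * divs z u j) k.

Lemma disc_series_flip y z u : disc_series u -> normc z < 1 ->
  disc_series (flip y z u).
Proof.
move=> us z1; have ds := disc_series_divs us z1.
apply: disc_seriesD; first exact: disc_seriesZ.
by apply: disc_series_cons; exact: disc_seriesZ.
Qed.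

Lemma ev_flip y z u w : disc_series u -> normc z < 1 -> normc w < 1 ->
  ev (flip y z u) w = (y%:C - z^*%C / y%:C * w) * ev (divs z u) w.
Proof.
move=> us z1 w1; have ds := disc_series_divs us z1.
rewrite evD //; [|exact: disc_seriesZ|by apply: disc_series_cons; exact: disc_seriesZ].
by rewrite ev_cons ?evZ //; [ring | exact: disc_seriesZ].
Qed.

(** The root of this factor, if any, is [y^2 / conj z], whose modulus exceeds [y]. *)
Lemma flip_factor_neq0 y z w : normc z < y -> normc w <= y ->
  y%:C - z^*%C / y%:C * w != 0.
Proof.
move=> zy wy; have y0 : 0 < y by apply: le_lt_trans zy; exact: normc_ge0.
rewrite subr_eq0; apply/eqP => /(congr1 (fun t => normc t)).
rewrite !normcM normcV normc_conj !normc_real gtr0_norm // => E.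
suff : normc z / y * normc w < y by rewrite -E ltxx.
rewrite mulrAC ltr_pdivrMr //.
have := normc_ge0 w; have := normc_ge0 z; nra.
Qed.

(** As [u 0 = - z d_0] for the quotient [d], a flip at [z != 0] multiplies [|u 0|] by [y / |z|].
    This gain limits the number of zeros, as in Jensen's formula. *)
Lemma flip_at0 y z u : disc_series u -> normc z < 1 -> 0 <= y -> ev u z = 0 ->
  normc (flip y z u 0%N) * normc z = y * normc (u 0%N).
Proof.
move=> us z1 y0 uz; have := divs0 us z1; rewrite uz => /eqP.
rewrite eq_sym addr_eq0 => /eqP ->.
rewrite normc_opp !normcM /flip /= addr0 normcM normc_real ger0_norm //; ring.
Qed.

(** By Parseval, a bound on the quadratic mean of [u] over the circle of radius [y], stated without
    an integral. *)
Definition l2_bound y u M := forall n, \sum_(k < n) (normc (u k) * y ^+ k) ^+ 2 <= M.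

Lemma geometric_small q M e n : 0 <= q -> q < 1 -> 0 < e ->
  exists2 N, (n <= N)%N & M * q ^+ N <= e.
Proof.
move=> q0 q1 e0.
have h : (fun N => M * q ^+ N) @ \oo --> (0 : R).
  rewrite -[X in _ --> X](mulr0 M); apply: cvgMl_tmp; apply: cvg_expr.
  by rewrite ger0_norm.
have [N _ HN] := (cvgr_lt _ h) _ e0.
exists (maxn n N); first exact: leq_maxl.
by apply: ltW; apply: HN; exact: leq_maxr.
Qed.

Lemma ler_sum_widen (f : nat -> R) n N : (forall k, 0 <= f k) -> (n <= N)%N ->
  \sum_(k < n) f k <= \sum_(k < N) f k.
Proof.
move=> f0 nN; rewrite (big_ord_widen N f nN) [leRHS](bigID (fun k : 'I_N => (k < n)%N)) /=.
by rewrite lerDl sumr_ge0.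
Qed.

Lemma normc_flip_identity y (z a b : R[i]) :
  normc (y%:C ^+ 2 * a - z^*%C * b) ^+ 2 =
  normc (b - z * a) ^+ 2 * y ^+ 2 +
  (y ^+ 2 - normc z ^+ 2) * (normc a ^+ 2 * y ^+ 2) -
  (y ^+ 2 - normc z ^+ 2) * normc b ^+ 2.
Proof.
by case: z a b => [z1 z2] [a1 a2] [b1 b2]; rewrite !normc_sqr /=; ring.
Qed.

(** The two factors have equal modulus on the circle, so the full Parseval sums agree. Partial sums
    differ by the boundary term [(y^2 - |z|^2) |d_N|^2 y^(2N)], where [d] is the quotient, and this
    tends to 0. *)
Lemma l2_bound_flip y z u M : disc_series u -> normc z < y -> y < 1 ->
  ev u z = 0 -> l2_bound y u M -> l2_bound y (flip y z u) M.
Proof.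
move=> us zy y1 uz uM n; have y0 : 0 < y by apply: le_lt_trans zy; exact: normc_ge0.
have z1 : normc z < 1 by exact: lt_trans y1.
pose d := divs z u.
have key N : \sum_(k < N.+1) (normc (flip y z u k) * y ^+ k) ^+ 2 =
    \sum_(k < N.+1) (normc (u k) * y ^+ k) ^+ 2 +
    (y ^+ 2 - normc z ^+ 2) * (normc (d N) * y ^+ N) ^+ 2.
  elim: N => [|N IH].
    rewrite !big_ord1 /flip /= addr0 !normcM normc_real (gtr0_norm y0) !expr0 !mulr1.
    have := divs0 us z1; rewrite uz => /eqP; rewrite eq_sym addr_eq0 => /eqP ->.
    by rewrite normc_opp normcM /d; ring.
  rewrite big_ord_recr IH [in RHS]big_ord_recr /=.
  have -> : u N.+1 = d N - z * d N.+1 by rewrite /d divs_rec // addrK.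
  rewrite /flip /= -/d !exprMn.
  have yC : y%:C != 0 :> R[i] by rewrite -normc_eq0 normc_real gtr0_norm ?gt_eqF.
  suff E : normc (y%:C * d N.+1 - z^*%C / y%:C * d N) ^+ 2 * y ^+ 2 =
     normc (d N - z * d N.+1) ^+ 2 * y ^+ 2 +
      (y ^+ 2 - normc z ^+ 2) * (normc (d N.+1) ^+ 2 * y ^+ 2) -
      (y ^+ 2 - normc z ^+ 2) * normc (d N) ^+ 2.
    have E' : (y ^+ N.+1) ^+ 2 = y ^+ 2 * (y ^+ N) ^+ 2 by rewrite -exprMn -exprS.
    by rewrite mulNr E' [X in _ + X = _]mulrA E; ring.
  have E1 : normc (y%:C * d N.+1 - z^*%C / y%:C * d N) ^+ 2 * y ^+ 2 =
     normc (y%:C ^+ 2 * d N.+1 - z^*%C * d N) ^+ 2.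
    have -> : y ^+ 2 = normc y%:C ^+ 2 by rewrite normc_real gtr0_norm.
    by rewrite -exprMn -normcM; congr (normc _ ^+ 2); field.
  by rewrite E1 normc_flip_identity.
apply/ler_addgt0Pr => e e0.
have [M' [q [M'0 q0 q1 Hd]]] := disc_series_bound (disc_series_divs us z1) (ltW y0) y1.
have c0 : 0 <= y ^+ 2 - normc z ^+ 2.
  rewrite subr_ge0 lerXn2r ?nnegrE ?normc_ge0 ?ltW //.
have [N nN HN] := @geometric_small (q ^+ 2) ((y ^+ 2 - normc z ^+ 2) * M' ^+ 2) e n
   ltac:(exact: exprn_ge0) ltac:(by rewrite exprn_ilt1) e0.
apply: (@le_trans _ _ (\sum_(k < N.+1) (normc (flip y z u k) * y ^+ k) ^+ 2)).
  apply: (@ler_sum_widen (fun k => (normc (flip y z u k) * y ^+ k) ^+ 2)) => [k|].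
    exact: sqr_ge0.
  exact: leqW.
rewrite key; apply: lerD => //; apply: le_trans HN.
rewrite -mulrA ler_wpM2l // -exprM mulnC exprM -exprMn lerXn2r ?nnegrE //.
- by rewrite mulr_ge0 ?normc_ge0 ?exprn_ge0 // ltW.
- by rewrite mulr_ge0 ?exprn_ge0.
Qed.

End Flip.

(** * Zeros have finite order *)

Section Order.
Variable R : realType.
Implicit Types (u v : nat -> R[i]) (z w : R[i]) (x y M q : R).

(** Continuity of [chi] at [z], with [chi z != 0], is all the regularity of the cofactor that the
    perturbation in the maximum principle uses. *)
Definition finite_order u z y := exists k (chi : R[i] -> R[i]),
  [/\ ccvg chi z (chi z),
      chi z != 0 &
      forall w, normc w < y -> ev u w = (w - z) ^+ k * chi w].

Lemma l2_bound0 y u M : l2_bound y u M -> normc (u 0%N) ^+ 2 <= M.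
Proof. by move=> /(_ 1%N); rewrite big_ord1 expr0 mulr1. Qed.

Lemma l2_bound_exists y u : disc_series u -> 0 <= y -> y < 1 ->
  exists M, l2_bound y u M.
Proof.
move=> us y0 y1; have [M [q [M0 q0 q1 H]]] := disc_series_bound us y0 y1.
exists (M ^+ 2 * (1 - q ^+ 2)^-1) => n.
apply: (@le_trans _ _ (\sum_(k < n) M ^+ 2 * (q ^+ 2) ^+ k)).
  apply: ler_sum => k _; rewrite -exprM mulnC exprM -exprMn lerXn2r ?nnegrE //.
  - by rewrite mulr_ge0 ?normc_ge0 ?exprn_ge0.
  - by rewrite mulr_ge0 ?exprn_ge0.
rewrite -mulr_sumr ler_wpM2l ?sqr_ge0 // geometric_sum_le ?exprn_ge0 //.
by rewrite exprn_ilt1.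
Qed.

Lemma flip_gain y z u M N : disc_series u -> 0 < normc z -> normc z < y -> y < 1 ->
  ev u z = 0 -> M < normc (u 0%N) ^+ 2 * ((y / normc z) ^+ 2) ^+ N.+1 ->
  M < normc (flip y z u 0%N) ^+ 2 * ((y / normc z) ^+ 2) ^+ N.
Proof.
move=> us z0 zy y1 uz; rewrite [X in _ * X]exprS mulrA -exprMn.
have y0 : 0 <= y by exact: le_trans (ltW z0) (ltW zy).
have -> // : normc (u 0%N) * (y / normc z) = normc (flip y z u 0%N).
apply: (mulIf (lt0r_neq0 z0)); rewrite flip_at0 //; last exact: lt_trans y1.
by field; exact: lt0r_neq0.
Qed.

(** Each flip at a zero [z] multiplies [|u 0|^2] by [(y / |z|)^2] and preserves the bound [M]. By
    the last hypothesis, [N] flips would push [|u 0|^2] above [M], so the induction meets a series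
    that does not vanish at [z]. *)
Lemma finite_order_nonzero_at0 N y z M u : disc_series u -> 0 < normc z -> normc z < y -> y < 1 ->
  l2_bound y u M -> M < normc (u 0%N) ^+ 2 * ((y / normc z) ^+ 2) ^+ N ->
  finite_order u z y.
Proof.
move=> + z0 zy y1; have z1 := lt_trans zy y1.
elim: N u => [|N IH] u us uM hN.
  by move: hN; rewrite expr0 mulr1 ltNge (l2_bound0 uM).
have [uz|uz] := eqVneq (ev u z) 0; last first.
  exists 0%N, (ev u); split => //; first exact: ev_continuous.
  by move=> w _; rewrite expr0 mul1r.
have [k [chi [chi_cont chi_z Hchi]]] := IH (flip y z u) (disc_series_flip _ us z1)
  (l2_bound_flip us zy y1 uz uM) (flip_gain us z0 zy y1 uz hN).
exists k.+1, (fun w => chi w * (y%:C - z^*%C / y%:C * w)^-1); split.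
- have h := ccvgB (ccvg_cst y%:C z) (ccvgM (ccvg_cst (z^*%C / y%:C) z) (ccvg_id z)).
  exact: (ccvgM chi_cont (ccvgV (flip_factor_neq0 zy (ltW zy)) h)).
- by rewrite mulf_neq0 // invr_eq0 flip_factor_neq0 // ltW.
move=> w wy; have w1 := lt_trans wy y1.
have f0 := flip_factor_neq0 zy (ltW wy).
rewrite (ev_zero_divs us z1 w1 uz) exprS -mulrA; congr (_ * _).
apply: (mulfI f0); rewrite -ev_flip // Hchi //.
by rewrite [RHS]mulrCA [X in _ = _ * X]mulrCA mulfV // mulr1.
Qed.

Lemma ev_drop u j w : disc_series u -> normc w < 1 -> (forall i, (i < j)%N -> u i = 0) ->
  ev u w = w ^+ j * ev (fun i => u (j + i)%N) w.
Proof.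
move=> us w1; elim: j => [|j IH] H; first by rewrite expr0 mul1r.
rewrite IH; last by move=> i ij; apply: H; exact: ltnW.
rewrite ev_shift //; last exact: disc_series_drop.
rewrite addn0 H // add0r mulrA exprSr; congr (_ * ev _ w).
by apply/funext => i; rewrite addSnnS.
Qed.

(** Dropping the leading zero coefficients makes the constant term nonzero. At [z = 0] this already
    gives the factorisation; elsewhere [|z| / y < 1] provides the number of flips. *)
Lemma finite_order_neq0 u z : disc_series u -> normc z < 1 -> (exists j, u j != 0) ->
  exists2 y, normc z < y & finite_order u z y.
Proof.
move=> us z1 ex_j; have [j uj jmin] := ex_minnP ex_j.
have Hj i : (i < j)%N -> u i = 0.
  by move=> ij; apply/eqP; apply: contraTT ij => /jmin; rewrite -leqNgt.
have vs := disc_series_drop j us.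
have [z0|zn0] := eqVneq z 0.
  exists 1 => //; exists j, (ev (fun i => u (j + i)%N)); split.
  - exact: ev_continuous.
  - by rewrite z0 ev0 // addn0.
  - by move=> w w1; rewrite z0 subr0; exact: ev_drop.
have z_gt0 : 0 < normc z by rewrite normc_gt0.
have [y zy y1] : exists2 y, normc z < y & y < 1 by exists ((normc z + 1) / 2); lra.
have y0 : 0 < y := lt_trans z_gt0 zy.
have [M HM] := l2_bound_exists vs (ltW y0) y1.
have q0 : 0 <= (normc z / y) ^+ 2 by exact: sqr_ge0.
have q1 : (normc z / y) ^+ 2 < 1.
  by rewrite exprn_ilt1 // ?divr_ge0 ?ltW // ltr_pdivrMr // mul1r.
have u0 : 0 < normc (u (j + 0)%N) ^+ 2 / 2.
  by rewrite divr_gt0 // exprn_gt0 // normc_gt0 addn0.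
have [N _ HN] := geometric_small M 0 q0 q1 u0.
exists y => //.
have [k [chi [c1 c2 c3]]] : finite_order (fun i => u (j + i)%N) z y.
  apply: (@finite_order_nonzero_at0 N y z M) => //.
  rewrite -ltr_pdivrMr ?exprn_gt0 ?divr_gt0 //.
  rewrite -exprVn -exprVn invf_div.
  apply: le_lt_trans HN _; lra.
exists k, (fun w => w ^+ j * chi w); split.
- exact: (ccvgM (ccvgX j (ccvg_id z)) c1).
- by rewrite mulf_neq0 // expf_neq0.
- move=> w wy; rewrite (ev_drop us (lt_trans wy y1) Hj) c3 //; ring.
Qed.

End Order.

(** * Maximum principle for quotients *)

Section MaximumPrinciple.
Variable R : realType.
Implicit Types (u v : nat -> R[i]) (z w : R[i]) (x y M q r C : R).

(** Maxima are taken on compact subsets of [R * R], whose balls are squares; hence [d / 2] in each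
    coordinate. *)
Lemma continuous_on_plane (f : R[i] -> R) (p : R * R) :
  (forall e, 0 < e -> exists2 d, 0 < d & forall w, normc (w - Complex p.1 p.2) < d ->
     `|f w - f (Complex p.1 p.2)| < e) ->
  {for p, continuous (fun q : R * R => f (Complex q.1 q.2))}.
Proof.
move=> H; apply/cvgrPdist_lt => e e0; have [d d0 Hd] := H e e0.
apply/(@nbhs_ballP R (R * R)%type); exists (d / 2) => /=; first by rewrite divr_gt0.
move=> [a b] [/= h1 h2]; rewrite distrC; apply: Hd.
apply: le_lt_trans (normc_le_ReIm _) _; rewrite /=.
rewrite [X in X + _]distrC [X in _ + X]distrC.
have -> : d = d / 2 + d / 2 by field.
exact: ltrD.
Qed.

Definition plane_disc r : set (R * R) := [set p | normc (Complex p.1 p.2) <= r].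

Lemma compact_plane_disc r : compact (plane_disc r).
Proof.
apply: (@subclosed_compact _ _ (`[- r, r]%classic `*` `[- r, r]%classic)).
- have -> : plane_disc r = (fun q : R * R => normc (Complex q.1 q.2)) @^-1` [set x | x <= r].
    by [].
  apply: closed_comp; last exact: closed_le.
  move=> p _; apply: continuous_on_plane => e e0; exists e => // w h.
  apply: le_lt_trans h; rewrite ler_norml; apply/andP; split.
    rewrite lerNl opprB lerBlDr normcB.
    by rewrite -[X in normc X <= _](subrK w); exact: normc_triangle.
  by rewrite lerBlDr -[X in normc X <= _](subrK (Complex p.1 p.2)); exact: normc_triangle.
- by apply: compact_setX; exact: segment_compact.
- move=> [a b] /= h; have ha := le_trans (Re_le_normc _) h.
  have hb := le_trans (Im_le_normc _) h.
  by move: ha hb => /=; rewrite !ler_norml /= !in_itv /=.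
Qed.

Lemma normc_1D_gt1 z : 0 < complex.Re z -> 1 < normc (1 + z).
Proof.
move=> z0; apply: (@lt_le_trans _ _ (complex.Re (1 + z))).
  by case: z z0 => a b /= a0; rewrite ltrDl.
exact: le_trans (ler_norm _) (Re_le_normc _).
Qed.

Lemma normc_max_attained u v r : 0 <= r -> r < 1 -> disc_series u -> disc_series v ->
  (forall w, normc w <= r -> ev v w != 0) ->
  exists2 z, normc z <= r & forall w, normc w <= r ->
    normc (ev u w / ev v w) <= normc (ev u z / ev v z).
Proof.
move=> r0 r1 us vs v0; pose f w := normc (ev u w / ev v w).
have ne : plane_disc r !=set0 by exists (0, 0); change (normc (0 : R[i]) <= r); rewrite normc_0.
have cf : {within plane_disc r, continuous (fun q : R * R => f (Complex q.1 q.2))}.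
  apply: continuous_in_subspaceT => p; rewrite inE => pr.
  have p1 : normc (Complex p.1 p.2) < 1 by exact: le_lt_trans pr r1.
  apply: continuous_on_plane => e e0.
  have h := ccvgM (ev_continuous us p1) (ccvgV (v0 _ pr) (ev_continuous vs p1)).
  have [d d0 Hd] := ccvg_epsilon h e0.
  exists d => // w /Hd; apply: le_lt_trans; rewrite /f ler_norml; apply/andP; split.
    rewrite lerNl opprB lerBlDr [X in _ <= X + _]normcB.
    by rewrite -[X in normc X <= _](subrK (ev u w / ev v w)); exact: normc_triangle.
  rewrite lerBlDr.
  rewrite -[X in normc X <= _](subrK (ev u (Complex p.1 p.2) / ev v (Complex p.1 p.2))).
  exact: normc_triangle.
have [c cr cmax] := compact_EVT_max ne (@compact_plane_disc r) cf.
exists (Complex c.1 c.2); first by move: cr; rewrite inE.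
move=> w wr; have := cmax (complex.Re w, complex.Im w).
by rewrite inE /plane_disc /=; case: w wr => a b /= wr; apply.
Qed.

(* At an interior maximum point [z] of [|u / v|] with value [lam], write
   [u - lam v = (w - z)^k chi] and move from [z] in a direction which makes the
   perturbation a positive multiple of [lam]. *)
Lemma maximum_principle u v r C : 0 < r -> r < 1 -> disc_series u -> disc_series v ->
  (forall w, normc w <= r -> ev v w != 0) ->
  (forall w, normc w = r -> normc (ev u w) <= C * normc (ev v w)) ->
  forall w, normc w <= r -> normc (ev u w) <= C * normc (ev v w).
Proof.
have aux (a b c d e f : R[i]) : a * (b * c / d) * e / f = b * (a * (e / f * (c / d))).
  by ring.
move=> r0 r1 us vs v0 bd.
have [z zr zmax] := normc_max_attained (ltW r0) r1 us vs v0.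
suff H : normc (ev u z / ev v z) <= C.
  move=> w wr; have := le_trans (zmax w wr) H.
  by rewrite normcM normcV ler_pdivrMr // normc_gt0 v0.
have onbd w : normc w = r -> normc (ev u w / ev v w) <= C.
  by move=> wr; rewrite normcM normcV ler_pdivrMr ?bd // normc_gt0 v0 // wr.
have [zr'|zr'] := eqVneq (normc z) r; first exact: onbd.
have {zr'} zlt : normc z < r by rewrite lt_neqAle zr'.
have z1 : normc z < 1 by exact: lt_trans r1.
have vz := v0 z zr.
have [lam lamE] : exists lam, lam = ev u z / ev v z by exists (ev u z / ev v z).
rewrite -lamE in zmax *.
have [l0|l0] := eqVneq lam 0.
  apply: le_trans (onbd r%:C _); last by rewrite normc_real gtr0_norm.
  by rewrite l0 normc_0 normc_ge0.
pose F k := u k + (- lam) * v k.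
have Fs : disc_series F by apply: disc_seriesD => //; exact: disc_seriesZ.
have evF w : normc w < 1 -> ev F w = ev u w - lam * ev v w.
  by move=> w1; rewrite evD ?evZ ?mulNr //; exact: disc_seriesZ.
(* If every coefficient of [F] vanishes, the quotient is constantly [lam] and can be evaluated at
   the boundary point [r]. *)
have [Fn0|Fn0] := pselect (exists j, F j != 0); last first.
  have rr : normc r%:C = r by rewrite normc_real gtr0_norm.
  apply: le_trans (onbd r%:C rr).
  have F0 : F = fun=> 0.
    by apply/funext => j; apply/eqP/negPn/negP => h; apply: Fn0; exists j.
  have rr1 : normc r%:C < 1 by rewrite rr.
  have rrr : normc r%:C <= r by rewrite rr.
  have := evF _ rr1; rewrite F0 (ev_cst0 rr1) => /esym/eqP.
  by rewrite subr_eq0 => /eqP ->; rewrite (mulfK (v0 _ rrr)).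
have [y zy [k [chi [chi_cont chi_z Hchi]]]] := finite_order_neq0 Fs z1 Fn0.
exfalso.
have k0 : (0 < k)%N.
  rewrite lt0n; apply/eqP => k0; move: (Hchi z zy) chi_z.
  rewrite k0 expr0 mul1r evF // lamE (mulfVK vz) subrr => <-; by rewrite eqxx.
(* The direction [eta] satisfies [eta^k chi z = lam v(z)], so at [w = z + t eta] the quotient equals
   [lam (1 + t^k th)] with [th] close to 1. *)
pose kap := lam * ev v z / chi z.
pose eta := k.-root kap.
have etak : eta ^+ k = kap by exact: rootCK.
have kap0 : kap != 0.
  by apply: mulf_neq0; [exact: mulf_neq0 | rewrite invr_eq0].
have eta0 : eta != 0 by apply: contraNneq kap0 => e; rewrite -etak e expr0n gtn_eqF.
have hc := ccvgM (ccvgM chi_cont (ccvgV vz (ev_continuous vs z1)))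
  (ccvg_cst (ev v z / chi z) z).
have half0 : 0 < 2^-1 :> R by rewrite invr_gt0.
have [d d0 Hd] := ccvg_epsilon hc half0.
pose m := Num.min d (Num.min (y - normc z) (r - normc z)).
have m0 : 0 < m by rewrite !lt_min d0 !subr_gt0 zy.
have ne : 0 < normc eta by rewrite normc_gt0.
pose t := m / 2 / normc eta.
have t0 : 0 < t by rewrite !divr_gt0.
pose w := z + t%:C * eta.
have wz : normc (w - z) < m.
  rewrite /w addrC addKr normcM normc_real gtr0_norm // /t mulfVK ?gt_eqF //.
  by rewrite gtr_pMr // invf_lt1 // ltr1n.
move: wz; rewrite !lt_min => /andP[/Hd wd /andP[wy wr]].
have wle : normc w <= normc (w - z) + normc z.
  by rewrite -{1}[w](subrK z); exact: normc_triangle.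
have {}wy : normc w < y by rewrite (le_lt_trans wle) // -ltrBrDr.
have {}wr : normc w < r by rewrite (le_lt_trans wle) // -ltrBrDr.
have w1 := lt_trans wr r1.
have vw := v0 w (ltW wr).
pose th := chi w / ev v w * (ev v z / chi z).
have th_re : 0 < complex.Re th.
  have E1 : chi z / ev v z * (ev v z / chi z) = 1.
    by rewrite mulrA (mulfVK vz) (mulfV chi_z).
  cbv beta in wd; rewrite [X in _ - X]E1 in wd.
  have : `|complex.Re (th - 1)| < 2^-1 := le_lt_trans (Re_le_normc _) wd.
  rewrite ltr_norml => /andP[+ _].
  by case: (th) => a b /=; rewrite ltrBrDr; apply: lt_trans; rewrite addrC subr_gt0 invf_lt1 // ltr1n.
have E : ev u w / ev v w = lam * (1 + (t ^+ k)%:C * th).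
  have := evF w w1; rewrite (Hchi w wy) => /eqP; rewrite eq_sym subr_eq => /eqP ->.
  have -> : w - z = t%:C * eta by rewrite /w addrC addKr.
  rewrite exprMn etak -rmorphXn /= mulrDl addrC (mulfK vw) mulrDr mulr1.
  by rewrite aux.
have := zmax w (ltW wr); rewrite E normcM leNgt => /negP; apply.
rewrite ltr_pMr ?normc_gt0 //; apply: normc_1D_gt1.
have : 0 < t ^+ k by rewrite exprn_gt0.
by case: (th) th_re => a b /= a0 tk0; rewrite mul0r subr0 mulr_gt0.
Qed.

End MaximumPrinciple.

(** * Schwarz's lemma and Rogosinski's inequality *)

Section Schwarz.
Variable R : realType.
Implicit Types (u v : nat -> R[i]) (z w : R[i]) (x y M q r C : R).

Lemma schwarz_lemma_aux N r y M u v : 0 < r -> r < y -> y < 1 ->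
  disc_series u -> disc_series v -> v 0%N != 0 ->
  (forall w, normc w < 1 -> normc w * normc (ev u w) <= normc (ev v w)) ->
  l2_bound y v M -> M < normc (v 0%N) ^+ 2 * ((y / r) ^+ 2) ^+ N ->
  forall w, normc w <= r -> normc (ev u w) <= r^-1 * normc (ev v w).
Proof.
have aux (a b : R) k : a ^+ 2 * (b ^+ 2) ^+ k.+1 = (a * b) ^+ 2 * (b ^+ 2) ^+ k.
  by rewrite [X in _ * X = _]exprS (exprMn 2 a b) mulrA.
move=> r0 ry y1; have y0 := lt_trans r0 ry; have r1 := lt_trans ry y1.
elim: N u v => [|N IH] u v us vs v0 uv vM HN.
  by move: HN; rewrite expr0 mulr1 ltNge (l2_bound0 vM).
have [[z [zr vz]]|nz] := pselect (exists z, normc z <= r /\ ev v z = 0); last first.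
  apply: maximum_principle => //.
    by move=> w wr; apply/eqP => vw; apply: nz; exists w.
  move=> w wr; rewrite mulrC ler_pdivlMr // mulrC -wr uv // wr //.
have z1 := le_lt_trans zr r1.
have zy := le_lt_trans zr ry.
have zn0 : z != 0 by apply: contraNneq v0 => z0; rewrite -(ev0 vs) -[X in ev v X]z0 vz.
have z0 : 0 < normc z by rewrite normc_gt0.
have uz : ev u z = 0.
  apply/eqP; rewrite -normc_eq0 eq_le normc_ge0 andbT.
  by have := uv z z1; rewrite vz normc_0 pmulr_rle0.
have dus := disc_series_divs us z1; have dvs := disc_series_divs vs z1.
(* Prefixing a zero coefficient multiplies a series by [w]; both sides are then series, and the
   inequality extends to [w = z] by continuity. *)
have dom w : normc w < 1 ->
    normc w * normc (ev (divs z u) w) <= normc (ev (divs z v) w).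
  have off (x : R[i]) : normc x < 1 -> x != z ->
      normc (ev (cons_series 0 (divs z u)) x) <= normc (ev (divs z v) x).
    move=> x1 xz; rewrite ev_cons // add0r normcM.
    have xz0 : 0 < normc (x - z) by rewrite normc_gt0 subr_eq0.
    have := uv x x1; rewrite (ev_zero_divs us z1 x1 uz) (ev_zero_divs vs z1 x1 vz).
    by rewrite (normcM (x - z)) (normcM (x - z)) mulrCA ler_pM2l.
  move=> w1; rewrite -normcM -[X in normc X]add0r -ev_cons //.
  have [->|] := eqVneq w z; last exact: off.
  by apply: ev_dominated_at => //; exact: disc_series_cons.
have flips w (w1 : normc w < 1) : normc (ev (flip y z u) w) =
    normc (y%:C - z^*%C / y%:C * w) * normc (ev (divs z u) w).
  by rewrite ev_flip // normcM.
have flipsv w (w1 : normc w < 1) : normc (ev (flip y z v) w) =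
    normc (y%:C - z^*%C / y%:C * w) * normc (ev (divs z v) w).
  by rewrite ev_flip // normcM.
have key := IH (flip y z u) (flip y z v) (disc_series_flip _ us z1) (disc_series_flip _ vs z1).
move=> w wr; have w1 := le_lt_trans wr r1.
rewrite (ev_zero_divs us z1 w1 uz) (ev_zero_divs vs z1 w1 vz).
rewrite (normcM (w - z)) (normcM (w - z)) (mulrCA r^-1).
rewrite ler_wpM2l ?normc_ge0 //.
have f0 : 0 < normc (y%:C - z^*%C / y%:C * w).
  by rewrite normc_gt0 flip_factor_neq0 // (le_trans wr) // ltW.
rewrite -(ler_pM2l f0) (mulrCA _ r^-1) -(flips _ w1) -(flipsv _ w1); apply: key wr.
- apply/eqP => f00; have := flip_at0 vs z1 (ltW y0) vz.
  rewrite f00 normc_0 mul0r => /esym/eqP.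
  by rewrite mulf_eq0 gt_eqF //= normc_eq0 (negbTE v0).
- move=> x x1; rewrite (flips _ x1) (flipsv _ x1) (mulrCA (normc x)).
  by apply: ler_wpM2l (dom _ x1); exact: normc_ge0.
- exact: l2_bound_flip.
apply: lt_le_trans HN _.
(* Since [|z| <= r], a flip gains at least the factor [y / r], which pays for the decrease of
   [N]. *)
have g : normc (v 0%N) * (y / r) <= normc (flip y z v 0%N).
  rewrite mulrA ler_pdivrMr // mulrC -(flip_at0 vs z1 (ltW y0) vz).
  by rewrite ler_wpM2l ?normc_ge0.
rewrite aux.
apply: ler_wpM2r; first by rewrite exprn_ge0 // sqr_ge0.
have yr0 : 0 <= y / r by rewrite divr_ge0 // ltW.
have h0 : 0 <= normc (v 0%N) * (y / r) by rewrite mulr_ge0 // normc_ge0.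
by rewrite ler_pXn2r // nnegrE normc_ge0.
Qed.

Lemma ler_of_scaled (a x y : R) : 0 <= x -> a < 1 ->
  (forall r, a < r -> r < 1 -> r * x <= y) -> x <= y.
Proof.
move=> x0 a1 H; rewrite leNgt; apply/negP => yx.
have [xe|xn] := eqVneq x 0.
  have := H ((a + 1) / 2) ltac:(lra) ltac:(lra).
  by rewrite xe mulr0 leNgt -xe yx.
have {x0 xn} x0 : 0 < x by rewrite lt_def xn.
have [r [ar yr r1]] : exists r, [/\ a < r, y / x < r & r < 1].
  exists ((Num.max a (y / x) + 1) / 2).
  have yx1 : y / x < 1 by rewrite ltr_pdivrMr // mul1r.
  have : Num.max a (y / x) < 1 by rewrite gt_max a1.
  have : a <= Num.max a (y / x) by rewrite le_max lexx.
  have : y / x <= Num.max a (y / x) by rewrite le_max lexx orbT.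
  by move=> *; split; lra.
by have := H r ar r1; rewrite leNgt -ltr_pdivrMr // yr.
Qed.

(* Schwarz's lemma for the quotient [w u / v]: the zeros of [v] in a smaller disc
   are zeros of [u], and flipping them out of the disc in both series keeps
   [|u / v|] unchanged on that disc.  Each flip multiplies [|v 0|] by at least
   [y / r] while the l2 bound on [v] persists, so there are finitely many. *)
Lemma schwarz_lemma u v : disc_series u -> disc_series v -> v 0%N != 0 ->
  (forall w, normc w < 1 -> normc w * normc (ev u w) <= normc (ev v w)) ->
  forall w, normc w < 1 -> normc (ev u w) <= normc (ev v w).
Proof.
move=> us vs v0 uv w w1.
apply: (@ler_of_scaled (normc w)) => //; first exact: normc_ge0.
move=> r wr r1; have r0 : 0 < r by apply: le_lt_trans wr; exact: normc_ge0.
have [y ry y1] : exists2 y, r < y & y < 1 by exists ((r + 1) / 2); lra.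
have y0 := lt_trans r0 ry.
have [M HM] := l2_bound_exists vs (ltW y0) y1.
have q0 : 0 <= (r / y) ^+ 2 by exact: sqr_ge0.
have q1 : (r / y) ^+ 2 < 1.
  by rewrite exprn_ilt1 // ?divr_ge0 ?ltW // ltr_pdivrMr // mul1r.
have v00 : 0 < normc (v 0%N) ^+ 2 / 2 by rewrite divr_gt0 // exprn_gt0 // normc_gt0.
have [N _ HN] := geometric_small M 0 q0 q1 v00.
have HN' : M < normc (v 0%N) ^+ 2 * ((y / r) ^+ 2) ^+ N.
  rewrite -ltr_pdivrMr ?exprn_gt0 ?divr_gt0 // -exprVn -exprVn invf_div.
  by apply: le_lt_trans HN _; lra.
have := schwarz_lemma_aux r0 ry y1 us vs v0 uv HM HN' (ltW wr).
by rewrite [leRHS]mulrC ler_pdivlMr // [leLHS]mulrC.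
Qed.

Definition dominated u v := forall w, normc w < 1 -> normc (ev u w) <= normc (ev v w).

(** For [b = 1] this says that Blaschke maps preserve the disc. The homogeneous form keeps [u] and
    [v] apart and can also be applied coefficient by coefficient. *)
Lemma blaschke_identity (a b c : R[i]) :
  normc (b - c^*%C * a) ^+ 2 - normc (a - c * b) ^+ 2 =
  (1 - normc c ^+ 2) * (normc b ^+ 2 - normc a ^+ 2).
Proof.
by case: a b c => [a1 a2] [b1 b2] [c1 c2]; rewrite !normc_sqr /=; ring.
Qed.

(** With [omega = u / v] and [c = omega(0)], the quotient of [schur_num] by [schur_den] is Schur's
    transform [(omega - c) / (w (1 - conj c omega))]; the index shift is the division by [w]. *)
Definition schur_num c u v : nat -> R[i] := fun k => u k.+1 + (- c) * v k.+1.
Definition schur_den (c : R[i]) u v : nat -> R[i] := fun k => v k + (- c^*%C) * u k.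

Lemma disc_series_schur_num c u v : disc_series u -> disc_series v ->
  disc_series (schur_num c u v).
Proof.
move=> us vs; apply: (@disc_series_shift _ (fun k => u k + (- c) * v k)).
by apply: disc_seriesD => //; exact: disc_seriesZ.
Qed.

Lemma disc_series_schur_den c u v : disc_series u -> disc_series v ->
  disc_series (schur_den c u v).
Proof. by move=> us vs; apply: disc_seriesD => //; exact: disc_seriesZ. Qed.

Lemma schur_step u v : disc_series u -> disc_series v -> dominated u v ->
  normc (u 0%N) < normc (v 0%N) ->
  dominated (schur_num (u 0%N / v 0%N) u v) (schur_den (u 0%N / v 0%N) u v).
Proof.
move=> us vs uv uv0; have v0 : 0 < normc (v 0%N) by apply: le_lt_trans uv0; exact: normc_ge0.
have vn0 : v 0%N != 0 by rewrite -normc_gt0.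
set c := u 0%N / v 0%N.
have c1 : normc c < 1 by rewrite normcM normcV ltr_pdivrMr // mul1r.
have c2 : 0 < 1 - normc c ^+ 2 by rewrite subr_gt0 exprn_ilt1 // normc_ge0.
apply: schwarz_lemma; [exact: disc_series_schur_num|exact: disc_series_schur_den| |].
  rewrite /schur_den -normc_gt0; apply: lt_le_trans (_ : normc (v 0%N) - normc (c^*%C * u 0%N) <= _).
    rewrite subr_gt0 normcM normc_conj; apply: le_lt_trans uv0.
    by rewrite ler_piMl ?normc_ge0 // ltW.
  rewrite mulNr lerBlDr -[X in normc X <= _](subrK (c^*%C * u 0%N)).
  exact: normc_triangle.
move=> w w1; rewrite -normcM.
have -> : w * ev (schur_num c u v) w = ev u w - c * ev v w.
  have := @ev_shift _ (fun k => u k + (- c) * v k) w.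
  rewrite evD //; last exact: disc_seriesZ.
  rewrite evZ // mulNr mulNr /c (mulfVK vn0) subrr add0r -/c => -> //.
  by apply: disc_seriesD => //; exact: disc_seriesZ.
rewrite evD ?evZ //; last exact: disc_seriesZ.
rewrite mulNr -(@ler_pXn2r _ 2) ?nnegrE ?normc_ge0 // -subr_ge0 blaschke_identity.
by rewrite mulr_ge0 ?(ltW c2) // subr_ge0 lerXn2r ?nnegrE ?normc_ge0 // uv.
Qed.

(** Summed over coefficients, the Blaschke identity turns the inequality of length [n] for the Schur
    transform into that of length [n + 1] for [u] and [v]. This needs [|u 0| < |v 0|]: if [v 0 = 0]
    both series are divided by [w], and otherwise [u] is scaled by [t < 1] with [t^2] tending to
    1. *)
Theorem rogosinski n u v : disc_series u -> disc_series v -> dominated u v ->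
  \sum_(k < n) normc (u k) ^+ 2 <= \sum_(k < n) normc (v k) ^+ 2.
Proof.
elim: n u v => [|n IH] u v us vs uv; first by rewrite !big_ord0.
have strict u' : disc_series u' -> dominated u' v -> normc (u' 0%N) < normc (v 0%N) ->
    \sum_(k < n.+1) normc (u' k) ^+ 2 <= \sum_(k < n.+1) normc (v k) ^+ 2.
  move=> us' uv' uv0; have v0 : 0 < normc (v 0%N) by apply: le_lt_trans uv0; exact: normc_ge0.
  have vn0 : v 0%N != 0 by rewrite -normc_gt0.
  pose c := u' 0%N / v 0%N.
  have c1 : normc c < 1 by rewrite normcM normcV ltr_pdivrMr // mul1r.
  have c2 : 0 < 1 - normc c ^+ 2 by rewrite subr_gt0 exprn_ilt1 // normc_ge0.
  have := IH _ _ (disc_series_schur_num c us' vs) (disc_series_schur_den c us' vs)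
    (schur_step us' vs uv' uv0).
  have := @ler_sum_widen _ (fun k => normc (schur_den c u' v k) ^+ 2) n n.+1
    (fun k => sqr_ge0 _) (leqnSn n).
  move=> h1 h2; have := le_trans h2 h1.
  have -> : \sum_(k < n) normc (schur_num c u' v k) ^+ 2 =
      \sum_(k < n.+1) normc (u' k - c * v k) ^+ 2.
    rewrite big_ord_recl /= /c (mulfVK vn0) subrr normc_0 expr0n add0r.
    by apply: eq_bigr => k _; rewrite /schur_num mulNr.
  rewrite -subr_ge0 -sumrB.
  under eq_bigr do rewrite /schur_den mulNr blaschke_identity.
  by rewrite -mulr_sumr pmulr_rge0 // sumrB subr_ge0.
have uv0 : normc (u 0%N) <= normc (v 0%N) by rewrite -(ev0 us) -(ev0 vs) uv // normc_0.
have [v0|vn0] := eqVneq (v 0%N) 0.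
  have u0 : u 0%N = 0.
    by apply/eqP; rewrite -normc_eq0 eq_le normc_ge0 andbT; move: uv0; rewrite v0 normc_0.
  rewrite !big_ord_recl /= u0 v0 lerD2l.
  apply: (IH (fun k => u k.+1) (fun k => v k.+1));
    [exact: disc_series_shift|exact: disc_series_shift|].
  have off w : normc w < 1 -> w != 0 ->
      normc (ev (fun k => u k.+1) w) <= normc (ev (fun k => v k.+1) w).
    move=> w1 w0; have := uv w w1.
    rewrite (ev_shift us w1) (ev_shift vs w1) u0 v0 !add0r !normcM ler_pM2l //.
    by rewrite normc_gt0.
  move=> w w1; have [->|] := eqVneq w 0; last exact: off.
  apply: ev_dominated_at; [exact: disc_series_shift|exact: disc_series_shift|by rewrite normc_0|].
  exact: off.
have v0 : 0 < normc (v 0%N) by rewrite normc_gt0.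
apply: (@ler_of_scaled 0) => //; first by rewrite sumr_ge0 // => k _; exact: sqr_ge0.
move=> s s0 s1; pose t := Num.sqrt s.
have t0 : 0 < t by rewrite sqrtr_gt0.
have t1 : t < 1 by rewrite -sqrtr1 ltr_sqrt.
have := strict (fun k => t%:C * u k).
rewrite (_ : \sum_(k < n.+1) normc (t%:C * u k) ^+ 2 = s * \sum_(k < n.+1) normc (u k) ^+ 2).
  apply.
  - exact: disc_seriesZ.
  - move=> w w1; rewrite evZ // normcM normc_real gtr0_norm //.
    by apply: le_trans (uv w w1); rewrite ler_piMl ?normc_ge0 // ltW.
  - rewrite normcM normc_real gtr0_norm //; apply: le_lt_trans (_ : t * normc (v 0%N) < _).
      by rewrite ler_pM2l.
    by rewrite gtr_pMl.
rewrite mulr_sumr; apply: eq_bigr => k _.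
by rewrite normcM exprMn normc_real gtr0_norm // sqr_sqrtr // ltW.
Qed.

End Schwarz.

(** * Contractive coefficient sequences *)

Section Convolution.
Variable R : realType.
Implicit Types (u v q t c : nat -> R[i]) (z w : R[i]).

Definition conv q u : nat -> R[i] := fun k => \sum_(i < k.+1) q i * u (k - i)%N.

Definition unit_series : nat -> R[i] := fun k => (k == 0%N)%:R.

Lemma conv_recl q u :
  conv q u = fun k => q 0%N * u k + cons_series 0 (conv (fun i => q i.+1) u) k.
Proof.
apply/funext => -[|k]; rewrite /conv big_ord_recl /= subn0 ?big_ord0 //.
Qed.

(** Polynomial multipliers are enough, because the first [n] coefficients of a product see only [n]
    coefficients of each factor. *)
Lemma ev_conv n q u : (forall i, (n <= i)%N -> q i = 0) -> disc_series u ->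
  disc_series (conv q u) /\
  forall w, normc w < 1 -> ev (conv q u) w = (\sum_(i < n) q i * w ^+ i) * ev u w.
Proof.
elim: n q => [|n IH] q q0 us.
  have -> : conv q u = fun=> 0.
    by apply/funext => k; rewrite /conv big1 // => i _; rewrite q0 ?mul0r.
  split; first exact: disc_series_cst0.
  by move=> w w1; rewrite ev_cst0 // big_ord0 mul0r.
have q0' i : (n <= i)%N -> q i.+1 = 0 by move=> ni; exact: q0.
have [ds evS] := IH (fun i => q i.+1) q0' us.
have zs : disc_series (fun k => q 0%N * u k) by exact: disc_seriesZ.
have cs := disc_series_cons 0 ds.
rewrite conv_recl; split; first exact: disc_seriesD.
move=> w w1; rewrite evD // evZ // ev_cons // evS // add0r big_ord_recl /= expr0 mulr1.
rewrite mulrDl mulrA mulr_sumr; congr (_ + _ * _); apply: eq_bigr => i _.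
by rewrite /bump /= add1n exprS mulrCA.
Qed.

Lemma dominated_conv n q u v : (forall i, (n <= i)%N -> q i = 0) ->
  disc_series u -> disc_series v -> dominated u v -> dominated (conv q u) (conv q v).
Proof.
move=> q0 us vs uv w w1.
rewrite (ev_conv q0 us).2 // (ev_conv q0 vs).2 // !normcM.
by rewrite ler_wpM2l ?normc_ge0 // uv.
Qed.

Lemma eq_conv q q' u u' k : (forall i, (i <= k)%N -> q i = q' i) ->
  (forall i, (i <= k)%N -> u i = u' i) -> conv q u k = conv q' u' k.
Proof.
move=> qq uu; apply: eq_bigr => i _.
by rewrite qq ?uu ?leq_subr // -ltnS.
Qed.

Lemma conv_coef n q u k : (k < n)%N ->
  conv q u k = (\poly_(i < n) q i * \poly_(i < n) u i)`_k.
Proof.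
move=> kn; rewrite coefM; apply: eq_bigr => i _.
rewrite !coef_poly (leq_ltn_trans _ kn) ?(leq_ltn_trans _ kn) ?leq_subr //.
by rewrite -ltnS.
Qed.

(** Truncation at degree [k] reduces this to commutativity in the polynomial ring. *)
Lemma convCA q c v k : conv q (conv c v) k = conv c (conv q v) k.
Proof.
have E q' c' : conv q' (conv c' v) k =
   (\poly_(i < k.+1) q' i * (\poly_(i < k.+1) c' i * \poly_(i < k.+1) v i))`_k.
  rewrite coefM; apply: eq_bigr => i _; rewrite coef_poly ltn_ord.
  by rewrite (@conv_coef k.+1) // ltnS leq_subr.
by rewrite !E mulrCA.
Qed.

Lemma conv_solve v t : v 0%N != 0 -> exists c, forall k, conv c v k = t k.
Proof.
move=> v0.
(* Course-of-values recursion: [s n] lists the first [n] coefficients, each computed from all the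
   earlier ones. *)
pose s := fix s n : seq R[i] := if n is n'.+1 then
  rcons (s n') ((t n' - \sum_(i < n') (s n')`_i * v (n' - i)%N) / v 0%N) else [::].
have szs n : size (s n) = n by elim: n => //= n IH; rewrite size_rcons IH.
have ss n i : (i < n)%N -> (s n)`_i = (s i.+1)`_i.
  elim: n => // n IH; rewrite ltnS leq_eqVlt => /orP[/eqP -> //|ni].
  by rewrite {1}/s -/s nth_rcons szs ni IH.
exists (fun k => (s k.+1)`_k) => k; rewrite /conv big_ord_recr /= subnn.
rewrite nth_rcons szs ltnn eqxx (divfK v0).
under eq_bigr => i _ do rewrite -[rcons _ _]/(s i.+1) -(ss k) //.
by rewrite addrC subrK.
Qed.

(** The lower triangular Toeplitz matrices of [c] have l2 norm at most 1. This stands for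
    [|omega| <= 1] without any convergence of [c]. *)
Definition contractive c := forall t n,
  \sum_(k < n) normc (conv c t k) ^+ 2 <= \sum_(k < n) normc (t k) ^+ 2.

(** Writing [t = q v] formally gives [c t = q u]. Once [q] is truncated to a polynomial,
    [|q u| <= |q v|] in the disc and Rogosinski's inequality applies. *)
Lemma quotient_contractive u v c : disc_series u -> disc_series v -> dominated u v ->
  v 0%N != 0 -> (forall k, conv c v k = u k) -> contractive c.
Proof.
move=> us vs uv v0 cv t n; have [q Hq] := conv_solve t v0.
pose q' i := if (i < n)%N then q i else 0.
have q'0 i : (n <= i)%N -> q' i = 0 by rewrite /q' ltnNge => ->.
have q'q k i : (k < n)%N -> (i <= k)%N -> q' i = q i.
  by move=> kn ik; rewrite /q' (leq_ltn_trans ik kn).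
have := rogosinski n (ev_conv q'0 us).1 (ev_conv q'0 vs).1 (dominated_conv q'0 us vs uv).
congr (_ <= _); apply: eq_bigr => k _; congr (normc _ ^+ 2).
  rewrite (@eq_conv q' q u (conv c v) k); [|by move=> i; exact: q'q|by []].
  rewrite convCA; apply: eq_conv => // i ik; exact: Hq.
by rewrite (@eq_conv q' q v v k) ?Hq // => i; exact: q'q.
Qed.

Lemma conv_unit c k : conv c unit_series k = c k.
Proof.
rewrite /conv big_ord_recr /= subnn /unit_series eqxx mulr1n mulr1 big1 ?add0r // => i _.
by rewrite subn_eq0 leqNgt ltn_ord mulr0.
Qed.

Lemma l2_unit_series n : \sum_(k < n.+1) normc (unit_series k) ^+ 2 = 1.
Proof.
rewrite big_ord_recl big1 => [|i _]; last first.
  by rewrite /unit_series /= mulr0n normc_0 expr0n.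
by rewrite /unit_series eqxx mulr1n normc_1 addr0 expr1n.
Qed.

Lemma contractive_le1 c k : contractive c -> normc (c k) <= 1.
Proof.
move=> /(_ unit_series k.+1); under eq_bigr do rewrite conv_unit.
rewrite l2_unit_series big_ord_recr /= => h.
rewrite -(@ler_pXn2r _ 2) ?nnegrE ?normc_ge0 // expr1n; apply: le_trans h.
by rewrite lerDr sumr_ge0 // => i _; exact: sqr_ge0.
Qed.

(* Testing contractivity on [1 + s X^k] with [s = c_k conj(c_0) / (1 - |c_0|^2)]. *)
Lemma contractive_coef c k : contractive c -> (0 < k)%N ->
  normc (c k) <= 1 - normc (c 0%N) ^+ 2.
Proof.
case: k => // k cc _; set a := normc (c 0%N).
have a0 : 0 <= a by exact: normc_ge0.
have a1 : a <= 1 by exact: contractive_le1.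
set x := normc (c k.+1); have x0 : 0 <= x by exact: normc_ge0.
have key s : a ^+ 2 + normc (c k.+1 + s * c 0%N) ^+ 2 <= 1 + normc s ^+ 2.
  pose t j : R[i] := if j == 0%N then 1 else if j == k.+1 then s else 0.
  have tmid j : (0 < j)%N -> (j <= k)%N -> t j = 0.
    by case: j => // j _ jk; rewrite /t /= eqSS ltn_eqF.
  have tk : t k.+1 = s by rewrite /t /= eqxx.
  have := cc t k.+2.
  have -> : \sum_(j < k.+2) normc (t j) ^+ 2 = 1 + normc s ^+ 2.
    rewrite big_ord_recr big_ord_recl /= [X in normc X]/t /= normc_1 expr1n tk.
    rewrite big1 ?addr0 // => i _.
    by rewrite /bump /= add1n tmid // normc_0 expr0n.
  apply: le_trans; rewrite big_ord_recl big_ord_recr /=.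
  have -> : conv c t 0%N = c 0%N by rewrite /conv big_ord1 /t /= mulr1.
  rewrite lerD2l.
  have -> : bump 0 k = k.+1 by [].
  have -> : conv c t k.+1 = c k.+1 + s * c 0%N.
    rewrite /conv big_ord_recl big_ord_recr /= subn0 tk subnn.
    rewrite big1 => [|i _]; first by rewrite /t /= add0r mulr1 addrC mulrC.
    by rewrite /bump /= add1n subSS tmid ?mulr0 ?subn_gt0 ?leq_subr.
  by rewrite lerDr sumr_ge0 // => i _; exact: sqr_ge0.
(* For [a = 1] the test coefficient has a zero denominator, and [s = 0] already gives the claim. *)
have [a1'|a1'] := eqVneq a 1.
  have := key 0; rewrite mul0r addr0 normc_0 a1' expr1n expr0n addr0 gerDl subrr -/x.
  by move: x0; clear; nra.
have {}a1 : 0 < 1 - a ^+ 2 by rewrite subr_gt0 exprn_ilt1 // lt_neqAle a1'.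
set b := 1 - a ^+ 2 in a1 *.
have := key (c k.+1 * (c 0%N)^*%C * (b^-1)%:C).
have -> : c k.+1 + c k.+1 * (c 0%N)^*%C * (b^-1)%:C * c 0%N = c k.+1 * (b^-1)%:C.
  have -> : c k.+1 * (c 0%N)^*%C * (b^-1)%:C * c 0%N =
      c k.+1 * (b^-1)%:C * (a ^+ 2)%:C by rewrite /a normc_sqr_conj; ring.
  have -> : (a ^+ 2)%:C = 1 - b%:C :> R[i] by rewrite /b rmorphB rmorph1 subKr.
  by rewrite fmorphV; field; rewrite -normc_eq0 normc_real gtr0_norm ?gt_eqF.
rewrite !normcM normc_conj normc_real -/a -/x gtr0_norm ?invr_gt0 //.
move=> h; have {h} : (x / b) ^+ 2 * b <= b.
  have e : (x * a / b) ^+ 2 = (x / b) ^+ 2 * (1 - b) by rewrite /b subKr !exprMn; ring.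
  by move: h; rewrite e -[a ^+ 2](subKr 1) -/b; move: ((x / b) ^+ 2) (b) => S b'; lra.
rewrite -[leRHS]mul1r ler_pM2r // exprMn exprVn ler_pdivrMr ?exprn_gt0 // mul1r.
by rewrite ler_pXn2r // nnegrE ltW.
Qed.

End Convolution.
Arguments unit_series {R} k.

(** * Real majorant inequalities *)

Section Majorants.
Variable R : realType.
Implicit Types (alpha beta gamma w d : nat -> R) (rho x : R).

(** Summation by parts: as the partial sums are nonpositive, replacing all weights by the smallest
    one can only increase the sum. *)
Lemma abel_sum_le0 w d : (forall k, 0 <= w k) -> (forall k, w k.+1 <= w k) ->
  (forall n, \sum_(k < n) d k <= 0) -> forall n, \sum_(k < n) w k * d k <= 0.
Proof.
move=> w0 wS d0; case=> [|n]; first by rewrite big_ord0.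
apply: (@le_trans _ _ (w n * \sum_(k < n.+1) d k)); last first.
  by rewrite mulr_ge0_le0.
elim: n => [|n IH]; first by rewrite !big_ord1.
rewrite big_ord_recr [X in _ <= _ * X]big_ord_recr /= mulrDr lerD2r.
by apply: le_trans IH _; rewrite ler_wnM2r.
Qed.

Lemma power_sum_le (g : nat -> R) g0 g1 G rho n : 0 <= rho -> rho < 1 ->
  0 <= g1 -> 0 <= G -> g 0%N <= g0 -> g 1%N <= g1 ->
  (forall k, (2 <= k)%N -> g k <= G) ->
  \sum_(k < n.+1) rho ^+ k * g k <= g0 + rho * g1 + rho ^+ 2 * (G / (1 - rho)).
Proof.
move=> r0 r1 g10 G0 gg0 gg1 gG.
have t0 : 0 <= rho ^+ 2 * (G / (1 - rho)).
  by rewrite mulr_ge0 ?exprn_ge0 // divr_ge0 // subr_ge0 ltW.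
have t1 : 0 <= rho * g1 by rewrite mulr_ge0.
case: n => [|n]; first by rewrite big_ord1 expr0 mul1r; lra.
rewrite 2!big_ord_recl /= expr0 expr1 mul1r addrA; apply: lerD.
  by apply: lerD => //; rewrite ler_wpM2l.
apply: (@le_trans _ _ (rho ^+ 2 * (G * \sum_(k < n) rho ^+ k))).
  rewrite !mulr_sumr; apply: ler_sum => k _.
  rewrite /bump /= !add1n !exprS -!mulrA expr0 mul1r.
  rewrite ler_wpM2l // ler_wpM2l // mulrC ler_wpM2r ?exprn_ge0 // gG //.
by rewrite ler_wpM2l ?exprn_ge0 // ler_wpM2l // geometric_sum_le.
Qed.

(** Each term is split by [A r <= 7/20 A^2 + 5/7 r^2], since [7/20 * 5/7 = 1/4]. What remains,
    [a + 7/20 (1 - a^2)], increases on [[0, 2/3]] and equals 31/36 at 2/3. *)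
Lemma majorant_small alpha rho n : (forall k, 0 <= alpha k) ->
  (forall n, \sum_(k < n) alpha k ^+ 2 <= 1) -> alpha 0%N <= 2 / 3 ->
  0 <= rho -> rho < 1 ->
  \sum_(k < n) alpha k * rho ^+ k <= 31 / 36 + 5 / 7 * (rho ^+ 2 / (1 - rho ^+ 2)).
Proof.
move=> a0 a1 a23 r0 r1.
have r2 : rho ^+ 2 < 1 by rewrite exprn_ilt1.
have e0 : 0 <= rho ^+ 2 / (1 - rho ^+ 2) by rewrite divr_ge0 ?exprn_ge0 // subr_ge0 ltW.
case: n => [|n]; first by rewrite big_ord0; lra.
rewrite big_ord_recl /= expr0 mulr1.
have H : \sum_(k < n) alpha k.+1 * rho ^+ k.+1 <=
    7 / 20 * \sum_(k < n) alpha k.+1 ^+ 2 + 5 / 7 * (rho ^+ 2 * \sum_(k < n) (rho ^+ 2) ^+ k).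
  rewrite !mulr_sumr -big_split /=; apply: ler_sum => k _.
  have -> : rho ^+ 2 * (rho ^+ 2) ^+ k = (rho ^+ k.+1) ^+ 2 by rewrite -exprS exprAC.
  move: (alpha k.+1) (rho ^+ k.+1) => A r.
  have := sqr_ge0 (7 * A - 10 * r); nra.
have H1 : alpha 0%N ^+ 2 + \sum_(k < n) alpha k.+1 ^+ 2 <= 1.
  by have := a1 n.+1; rewrite big_ord_recl.
have H2 : rho ^+ 2 * \sum_(k < n) (rho ^+ 2) ^+ k <= rho ^+ 2 / (1 - rho ^+ 2).
  by rewrite ler_wpM2l ?exprn_ge0 // geometric_sum_le // exprn_ge0.
have := a0 0%N; move: H H1 H2 a23; clear.
move: (\sum_(k < n) alpha k.+1 * rho ^+ k.+1) (\sum_(k < n) alpha k.+1 ^+ 2)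
  (rho ^+ 2 * _) (rho ^+ 2 / _) (alpha 0%N) => A B C D a; nra.
Qed.

(** A weighted Cauchy-Schwarz estimate that becomes an equality, as [n] grows, for the Blaschke
    coefficients [alpha k.+1 = (1 - a^2) a^k]. The hypothesis on sums of squares is Schur's
    inequality, supplied by [schur_l2]. *)
Lemma majorant_large alpha rho n : (forall k, 0 <= alpha k) -> alpha 0%N <= 1 ->
  (forall k, (0 < k)%N -> alpha k <= 1 - alpha 0%N ^+ 2) ->
  (forall n, \sum_(k < n) alpha k.+1 ^+ 2 <=
     \sum_(k < n) if k == 0%N :> nat then (1 - alpha 0%N ^+ 2) ^+ 2
                  else alpha 0%N ^+ 2 * alpha k ^+ 2) ->
  0 <= rho -> rho < 1 -> rho <= alpha 0%N ->
  \sum_(k < n) alpha k * rho ^+ k <=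
    alpha 0%N + rho * (1 - alpha 0%N ^+ 2) / (1 - rho * alpha 0%N).
Proof.
move=> a0 a1 a2 a3 r0 r1 ra.
set a := alpha 0%N in a1 a2 a3 ra *.
have apos : 0 <= a := a0 0%N.
have c0 : 0 <= 1 - a ^+ 2 by rewrite subr_ge0 exprn_ile1.
have e1 : 0 < 1 - rho * a.
  by rewrite subr_gt0; apply: le_lt_trans r1; rewrite ler_piMr.
have B0 : 0 <= rho * (1 - a ^+ 2) / (1 - rho * a).
  by rewrite divr_ge0 ?(ltW e1) // mulr_ge0.
case: n => [|n]; first by rewrite big_ord0 addr_ge0.
rewrite big_ord_recl /= expr0 mulr1 lerD2l.
have [ae|an] := eqVneq a 1.
  rewrite big1 // => k _; suff -> : alpha (bump 0 k) = 0 by rewrite mul0r.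
  apply/eqP; rewrite eq_le a0 andbT; apply: le_trans (a2 _ _) _ => //.
  by rewrite ae expr1n subrr.
have {an} c1 : 0 < 1 - a ^+ 2 by rewrite subr_gt0 exprn_ilt1 // lt_neqAle an.
have [re|rn] := eqVneq rho 0.
  by rewrite big1 // => k _; rewrite re exprS mul0r mulr0.
have {rn r0} r0 : 0 < rho by rewrite lt_def rn.
have {apos} apos : 0 < a by exact: lt_le_trans ra.
(* The weights [x^k] decrease because [rho <= a], so Abel summation applies; [a^2 x = rho a] then
   lets [T] be absorbed into the left-hand side. *)
pose x := rho / a.
have x0 : 0 < x by rewrite divr_gt0.
have x1 : x <= 1 by rewrite ler_pdivrMr // mul1r.
have xa : x * a = rho by rewrite divfK // gt_eqF.
pose T := \sum_(k < n) x ^+ k * alpha k.+1 ^+ 2.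
have T0 : 0 <= T by apply: sumr_ge0 => k _; rewrite mulr_ge0 ?exprn_ge0 ?sqr_ge0 // ltW.
have HT : T <= (1 - a ^+ 2) ^+ 2 + a ^+ 2 * (x * T).
  have := @abel_sum_le0 (fun k => x ^+ k) (fun k => alpha k.+1 ^+ 2 -
     (if k == 0%N :> nat then (1 - a ^+ 2) ^+ 2 else a ^+ 2 * alpha k ^+ 2)).
  move=> /(_ (fun k => exprn_ge0 k (ltW x0))) h.
  have {h} := h _ _ n; rewrite (_ : \sum_(k < n) _ = T - \sum_(k < n) x ^+ k *
     (if k == 0%N :> nat then (1 - a ^+ 2) ^+ 2 else a ^+ 2 * alpha k ^+ 2)); last first.
    by rewrite /T -sumrB; apply: eq_bigr => k _; rewrite mulrBr.
  rewrite subr_le0 => h; apply: (le_trans (h _ _)).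
  - by move=> k; rewrite exprS ler_piMl // exprn_ge0 // ltW.
  - by move=> N; rewrite sumrB subr_le0.
  pose f k := x ^+ k * (if k == 0%N then (1 - a ^+ 2) ^+ 2 else a ^+ 2 * alpha k ^+ 2).
  have f0 k : 0 <= f k.
    apply: mulr_ge0; first by rewrite exprn_ge0 // ltW.
    by case: ifP => _; [exact: sqr_ge0 | apply: mulr_ge0; exact: sqr_ge0].
  apply: (@le_trans _ _ (\sum_(k < n.+1) f k)); first by rewrite big_ord_recr /= lerDl.
  rewrite big_ord_recl /f /= expr0 mul1r lerD2l /T !mulr_sumr; apply: ler_sum => k _.
  by rewrite /bump /= add1n exprS; lra.
have HT' : T * (1 - rho * a) <= (1 - a ^+ 2) ^+ 2.
  by move: HT; rewrite -xa; lra.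
(* With this [mu] the two halves of the arithmetic-geometric inequality have the same bound, and
   both are exact for the Blaschke coefficients. *)
pose mu := a / (1 - a ^+ 2).
have mu0 : 0 < mu by rewrite divr_gt0.
have e0 : 0 <= rho * a by rewrite mulr_ge0 ?ltW.
have e1' : rho * a < 1 by rewrite -subr_gt0.
have pt k : 2 * (alpha k.+1 * rho ^+ k.+1) <=
    mu * x * (x ^+ k * alpha k.+1 ^+ 2) + mu^-1 * (rho * a) * (rho * a) ^+ k.
  have -> : mu * x * (x ^+ k * alpha k.+1 ^+ 2) = mu * x ^+ k.+1 * alpha k.+1 ^+ 2.
    by rewrite (exprS x k); ring.
  rewrite -(mulrA mu^-1) -(exprS (rho * a)).
  have P0 : 0 < x ^+ k.+1 by rewrite exprn_gt0.
  have rE : (rho ^+ k.+1) ^+ 2 = x ^+ k.+1 * (rho * a) ^+ k.+1.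
    by rewrite -exprMn mulrCA xa -expr2 exprAC.
  have mP : 0 < mu * x ^+ k.+1 by rewrite mulr_gt0.
  rewrite -(ler_pM2l mP) mulrDr.
  have -> : mu * x ^+ k.+1 * (mu^-1 * (rho * a) ^+ k.+1) = (rho ^+ k.+1) ^+ 2.
    by rewrite rE; field; exact: lt0r_neq0.
  have := sqr_ge0 (mu * x ^+ k.+1 * alpha k.+1 - rho ^+ k.+1).
  move: (mu * x ^+ k.+1) (rho ^+ k.+1) (alpha k.+1) => A B C; clear; nra.
have S2 : 2 * \sum_(i < n) alpha i.+1 * rho ^+ i.+1 <=
    mu * x * T + mu^-1 * (rho * a) * (1 - rho * a)^-1.
  apply: (@le_trans _ _ (mu * x * T + mu^-1 * (rho * a) * \sum_(k < n) (rho * a) ^+ k)).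
    by rewrite /T !mulr_sumr -big_split; apply: ler_sum => k _; exact: pt.
  rewrite lerD2l ler_wpM2l ?geometric_sum_le // mulr_ge0 // invr_ge0 ltW //.
have -> : \sum_(i < n) alpha (bump 0 i) * rho ^+ bump 0 i = \sum_(i < n) alpha i.+1 * rho ^+ i.+1.
  by apply: eq_bigr.
have T1 : mu * x * T <= rho * (1 - a ^+ 2) / (1 - rho * a).
  rewrite ler_pdivlMr // -(mulrA (mu * x)); apply: le_trans (_ : mu * x * (1 - a ^+ 2) ^+ 2 <= _).
    by rewrite ler_wpM2l // mulr_ge0 ?ltW.
  by rewrite -xa /mu le_eqVlt; apply/orP; left; apply/eqP; field; exact: lt0r_neq0.
have T2 : mu^-1 * (rho * a) * (1 - rho * a)^-1 = rho * (1 - a ^+ 2) / (1 - rho * a).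
  by rewrite /mu; field; rewrite ?(lt0r_neq0 apos) ?(lt0r_neq0 c1) ?(lt0r_neq0 e1).
by move: S2; rewrite T2; move: T1; lra.
Qed.

Lemma triangle_sum (F : nat -> nat -> R) n :
  \sum_(k < n) \sum_(i < k.+1) F i (k - i)%N = \sum_(j < n) \sum_(i < n - j) F i j.
Proof.
elim: n => [|n IH]; first by rewrite !big_ord0.
rewrite big_ord_recr IH /= [in RHS]big_ord_recr /= subSnn big_ord1.
rewrite (_ : \sum_(j < n) \sum_(i < n.+1 - j) F i j =
  \sum_(j < n) (\sum_(i < n - j) F i j) + \sum_(j < n) F (n - j)%N j); last first.
  by rewrite -big_split; apply: eq_bigr => j _; rewrite subSn 1?ltnW // big_ord_recr.
rewrite -addrA; congr (_ + _).
rewrite big_ord_recl subn0 addrC; congr (_ + _).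
rewrite [RHS](reindex_inj rev_ord_inj) /=; apply: eq_bigr => i _.
by rewrite /bump /= add1n subKn.
Qed.

(** After exchanging the sums, [alpha j * rho^j] is multiplied by a factor whose excess over 1 is at
    most [(1 - c) (2 Q j - 1)]. The weights make this negative at [j = 0], where [alpha] is at least
    2/3, and that outweighs all [j >= 2]. *)
Lemma majorant_transfer alpha beta gamma rho n :
  (forall k, 0 <= alpha k) -> (forall k, 0 <= gamma k) ->
  2 / 3 <= alpha 0%N -> alpha 0%N <= 1 ->
  (forall k, (0 < k)%N -> alpha k <= 1 - alpha 0%N ^+ 2) ->
  gamma 0%N <= 1 -> (forall k, (0 < k)%N -> gamma k <= 1 - gamma 0%N ^+ 2) ->
  (forall k, beta k <= \sum_(i < k.+1) gamma i * alpha (k - i)%N *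
     ((k - i).+1%:R / k.+1%:R)) ->
  0 <= rho -> rho <= 117 / 250 ->
  \sum_(k < n) beta k * rho ^+ k <= \sum_(k < n) alpha k * rho ^+ k.
Proof.
move=> a0 g0 a23 a1 a2 g1 g2 H r0 r1.
have r1' : rho < 1 by lra.
(* Bounds at [rho = 117/250] for [rho] times the sum of [rho^i (j + 1) / (i + j + 2)]. The value 1/2
   at [j = 1] is neutral, and 89/100 bounds the unweighted [rho / (1 - rho)]. *)
pose Q j : R := if j is j'.+1 then if j' is 0 then 1 / 2 else 89 / 100 else 89 / 250.
set c := gamma 0%N in g1 g2 *.
have c0 : 0 <= c := g0 0%N.
have c2 : 0 <= 1 - c ^+ 2 by rewrite subr_ge0 exprn_ile1.
pose f i j : R := gamma i * rho ^+ i * (j.+1%:R / (i + j).+1%:R).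
have Q0 j : 0 <= Q j by case: j => [|[|j]] /=; lra.
have r2 : rho ^+ 2 <= 11 / 50.
  by nra.
have t0 : 0 < 1 - rho by lra.
have tt : rho ^+ 2 * (1 - rho)^-1 <= 5 / 12.
  by rewrite ler_pdivrMr //; lra.
have tt0 : 0 <= rho ^+ 2 * (1 - rho)^-1 by rewrite mulr_ge0 ?exprn_ge0 // invr_ge0 ltW.
have Hq j N : rho * (\sum_(i < N) rho ^+ i * (j.+1%:R / (i + j).+2%:R)) <= Q j.
  case: N => [|N]; first by rewrite big_ord0 mulr0.
  pose g i : R := j.+1%:R / (i + j).+2%:R.
  have bound g0' g1' G : 0 <= g1' -> 0 <= G -> g 0%N <= g0' -> g 1%N <= g1' ->
      (forall k, (2 <= k)%N -> g k <= G) ->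
      rho * (g0' + rho * g1' + rho ^+ 2 * (1 - rho)^-1 * G) <= Q j ->
      rho * (\sum_(i < N.+1) rho ^+ i * g i) <= Q j.
    move=> h1 h2 h3 h4 h5; apply: le_trans; rewrite ler_wpM2l //.
    by rewrite mulrAC -mulrA; exact: power_sum_le.
  case: j @g bound => [|[|j]] g bound.
  - apply: (bound (1 / 2) (1 / 3) (1 / 4)); rewrite /g ?add0n ?addn0 ?addn1; try lra.
      move=> k k2; rewrite ler_pdivrMr ?ltr0n //.
      have : 4 <= (k + 0).+2%:R :> R by rewrite ler_nat addn0 !ltnS.
      lra.
    by rewrite /Q; nra.
  - apply: (bound (2 / 3) (1 / 2) (2 / 5)); rewrite /g ?add0n ?addn0 ?addn1; try lra.
      move=> k k2; rewrite ler_pdivrMr ?ltr0n //.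
      have : 5 <= (k + 1).+2%:R :> R by rewrite addn1 ler_nat !ltnS.
      lra.
    by rewrite /Q; nra.
  - apply: (bound 1 1 1); rewrite /g ?ler01 //.
    + by rewrite ler_pdivrMr ?ltr0n // mul1r ler_nat.
    + by rewrite ler_pdivrMr ?ltr0n // mul1r ler_nat ltnS ltnW // leqW.
    + by move=> k _; rewrite ler_pdivrMr ?ltr0n // mul1r ler_nat ltnS leqW // leq_addl.
    by rewrite /Q; nra.
(* The sum is at most [c + (1 - c^2) Q j], and [1 + c <= 2] makes the bound affine in [1 - c]. *)
have Hf j N : \sum_(i < N) f i j <= 1 + (1 - c) * (2 * Q j - 1).
  case: N => [|N].
    by rewrite big_ord0; have := Q0 j; move: (Q j) => q q0; nra.
  rewrite big_ord_recl /f /= expr0 mulr1 add0n divff ?pnatr_eq0 // mulr1 -/c.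
  apply: (@le_trans _ _ (c + (1 - c ^+ 2) * Q j)); last first.
    have := mulr_ge0 (sqr_ge0 (1 - c)) (Q0 j); move: (Q j) => q; lra.
  rewrite lerD2l; apply: le_trans (ler_wpM2l c2 (Hq j N)).
  rewrite !mulr_sumr; apply: ler_sum => i _; rewrite /bump /= add1n addSn exprS !mulrA.
  rewrite ler_wpM2r ?invr_ge0 // ler_wpM2r // ler_wpM2r ?exprn_ge0 // ler_wpM2r // g2 //.
apply: (@le_trans _ _ (\sum_(j < n) alpha j * rho ^+ j * \sum_(i < n - j) f i j)).
  rewrite [leRHS](eq_bigr (fun j : 'I_n => \sum_(i < n - j) (alpha j * rho ^+ j * f i j))); last first.
    by move=> j _; rewrite mulr_sumr.
  rewrite -(triangle_sum (fun i j => alpha j * rho ^+ j * f i j)).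
  apply: ler_sum => k _; apply: (@le_trans _ _ ((\sum_(i < k.+1) gamma i * alpha (k - i)%N *
     ((k - i).+1%:R / k.+1%:R)) * rho ^+ k)); first by rewrite ler_wpM2r // exprn_ge0.
  rewrite mulr_suml; apply: ler_sum => i _; rewrite /f.
  have ik : (i <= k)%N by rewrite -ltnS.
  have -> : rho ^+ k = rho ^+ i * rho ^+ (k - i) by rewrite -exprD subnKC.
  rewrite subnKC //.
  rewrite le_eqVlt; apply/orP; left; apply/eqP; ring.
rewrite -subr_le0 -sumrB.
apply: (@le_trans _ _ ((1 - c) * \sum_(j < n) rho ^+ j * (alpha j * (2 * Q j - 1)))).
  rewrite mulr_sumr; apply: ler_sum => j _.
  have := Hf j (n - j)%N; have : 0 <= alpha j * rho ^+ j by rewrite mulr_ge0 ?exprn_ge0.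
  move: (\sum_(i < n - j) f i j) (alpha j) (rho ^+ j) (Q j) => A B C D; nra.
apply: mulr_ge0_le0; first by rewrite subr_ge0.
case: n => [|n]; first by rewrite big_ord0.
(* Here [24/125 = 2/3 * (1 - 2 * 89/250)] and [13/30 = 5/9 * 39/50], where [5/9 = 1 - (2/3)^2]
   bounds the later [alpha k]. *)
apply: (@le_trans _ _ (- (24 / 125) + rho * 0 + rho ^+ 2 * (13 / 30 / (1 - rho)))).
  apply: (@power_sum_le (fun j => alpha j * (2 * Q j - 1))) => //; rewrite /=; try lra.
  move=> k k2; have k0 : (0 < k)%N by exact: ltnW.
  have -> : 2 * Q k - 1 = 39 / 50 by case: k k2 {k0} => [|[|k]] // _; rewrite /Q; field.
  by have := a2 k k0; nra.
by rewrite mulrCA; lra.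
Qed.

(** The sequence [gamma] holds the moduli of the coefficients of [omega]. It is requested only for
    [alpha 0 != 0], where formal division is possible; below 2/3 the l2 inequalities settle both
    sums. *)
Lemma majorant_sum_le alpha beta rho B n :
  (forall k, 0 <= alpha k) -> (forall k, 0 <= beta k) ->
  (forall n, \sum_(k < n) alpha k ^+ 2 <= 1) ->
  (forall k, (0 < k)%N -> alpha k <= 1 - alpha 0%N ^+ 2) ->
  (forall n, \sum_(k < n) alpha k.+1 ^+ 2 <=
     \sum_(k < n) if k == 0%N :> nat then (1 - alpha 0%N ^+ 2) ^+ 2
                  else alpha 0%N ^+ 2 * alpha k ^+ 2) ->
  (forall n, \sum_(k < n) beta k ^+ 2 <= \sum_(k < n) alpha k ^+ 2) ->
  (alpha 0%N != 0 -> exists gamma, [/\ forall k, 0 <= gamma k, gamma 0%N <= 1,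
     forall k, (0 < k)%N -> gamma k <= 1 - gamma 0%N ^+ 2 &
     forall k, beta k <= \sum_(i < k.+1) gamma i * alpha (k - i)%N *
       ((k - i).+1%:R / k.+1%:R)]) ->
  0 <= rho -> rho <= 117 / 250 ->
  31 / 36 + 5 / 7 * (rho ^+ 2 / (1 - rho ^+ 2)) <= B ->
  (forall a, 2 / 3 <= a -> a <= 1 -> a + rho * (1 - a ^+ 2) / (1 - rho * a) <= B) ->
  \sum_(k < n) (alpha k + beta k) * rho ^+ k <= 2 * B.
Proof.
move=> a0 b0 a1 a2 a3 b1 b2 r0 r1 B1 B2.
have r1' : rho < 1 by lra.
have a01 : alpha 0%N <= 1.
  have := a1 1%N; rewrite big_ord1 => h.
  by rewrite -(@ler_pXn2r _ 2) ?nnegrE ?a0 // expr1n.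
have -> : \sum_(k < n) (alpha k + beta k) * rho ^+ k =
  \sum_(k < n) alpha k * rho ^+ k + \sum_(k < n) beta k * rho ^+ k.
  by rewrite -big_split; apply: eq_bigr => k _; rewrite mulrDl.
rewrite mulr_natl mulr2n.
have [a23|a23] := leP (alpha 0%N) (2 / 3).
  have b01 : beta 0%N <= alpha 0%N.
    have := b1 1%N; rewrite !big_ord1 => h.
    by rewrite -(@ler_pXn2r _ 2) ?nnegrE ?a0 ?b0.
  apply: lerD; apply: le_trans B1; apply: majorant_small => //.
    by move=> N; exact: le_trans (b1 N) (a1 N).
  exact: le_trans b01 a23.
have an0 : alpha 0%N != 0 by rewrite gt_eqF //; apply: lt_trans a23; lra.
have [gamma [g0 g1 g2 g3]] := b2 an0.
have Ha : \sum_(k < n) alpha k * rho ^+ k <= B.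
  apply: le_trans (B2 _ (ltW a23) a01); apply: majorant_large => //.
  apply: ltW; apply: le_lt_trans a23; lra.
apply: lerD => //; apply: le_trans Ha.
by apply: (@majorant_transfer _ _ gamma) => //; exact: ltW.
Qed.

End Majorants.

(** * Derivatives of power series *)

Section Differentiation.
Variable R : realType.
Implicit Types (u v a b : nat -> R[i]) (z w l : R[i]) (f g h : R[i] -> R[i]) (x y M q r : R).

Lemma ctendsP u l : ((u : nat -> R[i]^o) n @[n --> \oo] --> (l : R[i]^o)) <-> ctends u l.
Proof.
split => [/(@cvgrPdist_lt _ (R[i]^o) nat \oo _ u l) H|H].
  apply/cvgrPdist_lt => e e0.
  have e0' : 0 < e%:C :> R[i] by rewrite ltcR.
  have := H _ e0'; apply: filterS => n.
  by rewrite normC_normc ltcR normcB sub0r normrN ger0_norm // normc_ge0.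
apply/(@cvgrPdist_lt _ (R[i]^o) nat \oo _ u l) => e.
rewrite ltcE /= => /andP[/eqP e_im e0].
move/cvgrPdist_lt : H => /(_ _ e0); apply: filterS => n.
rewrite normC_normc ltcE /= e_im eqxx /= normcB.
by rewrite sub0r normrN ger0_norm // normc_ge0.
Qed.

Lemma ctends_bounded u l : ctends u l -> exists M, forall n, normc (u n) <= M.
Proof.
move=> /cvgrPdist_lt /(_ 1 ltr01)[N _ HN].
exists (1 + normc l + \sum_(k < N) normc (u k)) => n.
have s0 : 0 <= \sum_(k < N) normc (u k) by apply: sumr_ge0 => k _; exact: normc_ge0.
have [nN|Nn] := ltnP n N.
  rewrite (bigD1 (Ordinal nN)) //= addrCA lerDl addr_ge0 //.
    by rewrite addr_ge0 // normc_ge0.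
  by apply: sumr_ge0 => k _; exact: normc_ge0.
have := HN n Nn; rewrite /= sub0r normrN ger0_norm ?normc_ge0 // => h.
have := normc_triangle (u n - l) l; rewrite subrK; move: h s0; clear.
move: (normc (u n - l)) (normc (u n)) (normc l) (\sum_(k < N) _) => A B C D; lra.
Qed.

Lemma root_exists x n : 0 < x -> x < 1 -> (0 < n)%N ->
  exists y, [/\ 0 < y, y < 1 & y ^+ n = x].
Proof.
move=> x0 x1 n0; exists (x `^ n%:R^-1).
have y0 : 0 < x `^ n%:R^-1 by exact: powR_gt0.
have yx : (x `^ n%:R^-1) ^+ n = x.
  by rewrite -powR_mulrn ?(ltW y0) // -powRrM mulVf ?pnatr_eq0 ?gtn_eqF // powRr1 // ltW.
split => //; rewrite ltNge; apply/negP => y1.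
by move: x1; rewrite -yx ltNge exprn_ege1.
Qed.

(** The terms of the convergent series at [y], where [y^p = (x + 1) / 2], are bounded as differences
    of partial sums. *)
Lemma power_series_disc p m a h : (0 < p)%N -> power_series_in_disc p m a h ->
  disc_series a.
Proof.
move=> p0 H x x0 x1.
have [y [y0 y1 yp]] := @root_exists ((x + 1) / 2) p ltac:(lra) ltac:(lra) p0.
have yd : unit_disc y%:C by rewrite /unit_disc /= normc_real gtr0_norm.
have /ctendsP Hs := H _ yd.
have [M HM] := ctends_bounded Hs.
have ym : 0 < y ^+ m by rewrite exprn_gt0.
exists ((M + M) / y ^+ m) => k; rewrite ler_pdivlMr //.
apply: (@le_trans _ _ (normc (a k * y%:C ^+ (p * k + m)))).
  rewrite normcM normcX normc_real gtr0_norm // exprD exprM yp -mulrA.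
  rewrite ler_wpM2l ?normc_ge0 // ler_wpM2r ?(ltW ym) // lerXn2r ?nnegrE; lra.
have -> : a k * y%:C ^+ (p * k + m) =
    series (fun j => a j * y%:C ^+ (p * j + m)) k.+1 -
    series (fun j => a j * y%:C ^+ (p * j + m)) k.
  by rewrite /series /= big_nat_recr //= addrAC subrr add0r.
by apply: le_trans (normc_triangleB _ _) _; apply: lerD; exact: HM.
Qed.

Lemma power_series_ev p m a h z : (0 < p)%N -> power_series_in_disc p m a h ->
  normc z < 1 -> h z = z ^+ m * ev a (z ^+ p).
Proof.
move=> p0 H z1; have as_ := power_series_disc p0 H.
have zp1 : normc (z ^+ p) < 1 by rewrite normcX exprn_ilt1 ?normc_ge0 // -lt0n.
have /ctendsP Hs := H z z1.
apply: ctends_unique Hs _.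
have := ctendsM (ctends_cst (z ^+ m)) (evP as_ zp1); congr (ctends _ _).
apply/funext => n; rewrite /psum /series /= big_mkord mulr_sumr; apply: eq_bigr => k _.
by rewrite -exprM exprD mulrCA [z ^+ m * _]mulrC.
Qed.

Lemma disc_series_weight u : disc_series u -> disc_series (fun k => k%:R * u k).
Proof.
move=> us x x0 x1; have [M [q [M0 q0 q1 H]]] := disc_series_bound us x0 x1.
exists (M * (1 - q)^-1) => k.
rewrite normcM -mulrA; apply: (@le_trans _ _ (k%:R * (M * q ^+ k))).
  have -> : normc k%:R = k%:R :> R.
    by rewrite -[k%:R](rmorph_nat (real_complex R)) normc_real ger0_norm.
  by rewrite ler_wpM2l.
rewrite mulrCA ler_wpM2l //; apply: le_trans (geometric_sum_le k q0 q1).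
rewrite mulr_natl -[k in _ *+ k]card_ord -sumr_const; apply: ler_sum => i _.
by apply: ler_wiXn2l; rewrite ?(ltW q1) ?(ltnW (ltn_ord i)).
Qed.

Lemma psumS u z n : psum u z n.+1 = psum u z n + u n * z ^+ n.
Proof. by rewrite /psum big_ord_recr. Qed.

(** The partial sums of the two series differ by [n d_n z^n], with [d] the quotient coefficients,
    and this tends to 0. *)
Lemma ev_divs_diag u z : disc_series u -> normc z < 1 ->
  ev (divs z u) z = ev (fun k => k.+1%:R * u k.+1) z.
Proof.
move=> us z1; have ds := disc_series_divs us z1.
have ws := disc_series_shift (disc_series_weight us).
apply: ctends_unique (evP ws z1).
have h1 := evP ds z1.
have h2 := evP (disc_series_weight ds) z1.
pose e n := n%:R * divs z u n * z ^+ n.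
have h3 : ctends e 0.
  have := ctendsD (ctends_shiftS h2) (ctendsM (ctends_cst (-1)) h2).
  rewrite mulN1r subrr; congr (ctends _ _).
  by apply/funext => n; rewrite /psum big_ord_recr /= mulN1r addrAC subrr add0r.
have := ctendsD h1 (ctendsM (ctends_cst (-1)) h3).
rewrite mulr0 addr0; congr (ctends _ _).
apply/funext; elim => [|n IH]; first by rewrite /psum !big_ord0 /e !mul0r mulr0 addr0.
rewrite !psumS -IH /e mulN1r.
rewrite [divs z u n]divs_rec // exprS -natr1.
move: (psum _ _ _) (divs z u n.+1) (u n.+1) (z ^+ n) n%:R => A B C D E.
ring.
Qed.

(** Caratheodory's form of the derivative, relative to the disc: product and composition rules
    become algebra and limits, without difference quotients. *)
Definition has_deriv f z l := exists theta,
  (forall w, normc w < 1 -> f w - f z = (w - z) * theta w) /\ ccvg theta z l.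

Lemma has_deriv_cst c z : has_deriv (fun=> c) z 0.
Proof.
by exists (fun=> 0); split; [move=> w _; rewrite subrr mulr0 | exact: (ccvg_cst 0 z)].
Qed.

Lemma has_derivM f g z l l' : has_deriv f z l -> has_deriv g z l' ->
  has_deriv (fun w => f w * g w) z (l * g z + f z * l').
Proof.
move=> [tf [Hf cf]] [tg [Hg cg]].
exists (fun w => tf w * (g z + (w - z) * tg w) + f z * tg w); split.
  move=> w w1; have -> : g z + (w - z) * tg w = g w by rewrite -Hg // addrC subrK.
  rewrite mulrDr mulrA -Hf // mulrCA -Hg //; ring.
have h := ccvgD (ccvg_cst (g z) z) (ccvgM (ccvgB (ccvg_id z) (ccvg_cst z z)) cg).
have := ccvgD (ccvgM cf h) (ccvgM (ccvg_cst (f z) z) cg).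
by rewrite subrr mul0r addr0.
Qed.

Lemma has_derivX n z : has_deriv (fun w => w ^+ n) z (n%:R * z ^+ n.-1).
Proof.
elim: n => [|n IH]; first by rewrite mul0r; exact: has_deriv_cst.
have idd : has_deriv id z 1.
  by exists (fun=> 1); split; [move=> w _; rewrite mulr1 | exact: (ccvg_cst 1 z)].
have := has_derivM idd IH.
rewrite (_ : 1 * z ^+ n + id z * (n%:R * z ^+ n.-1) = n.+1%:R * z ^+ n).
  by congr (has_deriv _ _ _); apply/funext => w; rewrite exprS.
by case: n {IH} => [|n]; rewrite /= -?natr1 ?exprS; ring.
Qed.

Lemma ccvg_comp f g z (c d : R[i]) : ccvg f z c -> ccvg g c d ->
  ccvg (fun w => g (f w)) z d.
Proof. by move=> fc gd; exact: cvg_comp fc gd. Qed.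

Lemma has_deriv_ev_pow u z p : disc_series u -> normc z < 1 -> (0 < p)%N ->
  has_deriv (fun w => ev u (w ^+ p)) z
    (p%:R * z ^+ p.-1 * ev (fun k => k.+1%:R * u k.+1) (z ^+ p)).
Proof.
move=> us z1 p0.
have pow1 (w : R[i]) : normc w < 1 -> normc (w ^+ p) < 1.
  by move=> w1; rewrite normcX exprn_ilt1 ?normc_ge0 // -lt0n.
have zp1 := pow1 z z1.
have [t [Ht ct]] := has_derivX p z.
exists (fun w => t w * ev (divs (z ^+ p) u) (w ^+ p)); split.
  move=> w w1; rewrite (ev_divs us zp1 (pow1 w w1)) [X in X - _]addrC addrK.
  by rewrite Ht // mulrA.
rewrite -(ev_divs_diag us zp1); apply: (ccvgM ct).
apply: (ccvg_comp (ccvgX p (ccvg_id z))).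
exact: ev_continuous (disc_series_divs us zp1) zp1.
Qed.

Lemma has_deriv_eq f g z l : (forall w, normc w < 1 -> f w = g w) -> normc z < 1 ->
  has_deriv f z l -> has_deriv g z l.
Proof.
move=> fg z1 [t [Ht ct]]; exists t; split => // w w1.
by rewrite -!fg // Ht.
Qed.

Lemma has_deriv_power_series p m a h z : (0 < p)%N -> (0 < m)%N ->
  power_series_in_disc p m a h -> normc z < 1 ->
  has_deriv h z (z ^+ m.-1 * ev (fun k => (p * k + m)%:R * a k) (z ^+ p)).
Proof.
move=> p0 m0 H z1; have as_ := power_series_disc p0 H.
have zp1 : normc (z ^+ p) < 1 by rewrite normcX exprn_ilt1 ?normc_ge0 // -lt0n.
have ws := disc_series_weight as_.
apply: (@has_deriv_eq (fun w => w ^+ m * ev a (w ^+ p))) => //.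
  by move=> w w1; rewrite (power_series_ev p0 H).
have := has_derivM (has_derivX m z) (has_deriv_ev_pow as_ z1 p0).
congr (has_deriv _ _ _).
have -> : ev (fun k => (p * k + m)%:R * a k) (z ^+ p) =
    p%:R * (z ^+ p * ev (fun k => k.+1%:R * a k.+1) (z ^+ p)) + m%:R * ev a (z ^+ p).
  rewrite (_ : (fun k => _) = fun k => p%:R * (k%:R * a k) + m%:R * a k); last first.
    by apply/funext => k; rewrite natrD natrM; ring.
  rewrite evD ?evZ //; [|exact: disc_seriesZ|exact: disc_seriesZ].
  by rewrite (ev_shift ws zp1) mul0r add0r.
have -> : z ^+ m = z ^+ m.-1 * z by rewrite -exprSr prednK.
have -> : z ^+ p = z * z ^+ p.-1 by rewrite -exprS prednK.
move: (ev _ _) (ev _ _) => A B; ring.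
Qed.

Lemma has_deriv_cderive f z l : normc z < 1 -> has_deriv f z l ->
  cderivable f z /\ cderive f z = l.
Proof.
move=> z1 [t [Ht ct]].
have H : (fun d : R[i]^o => d^-1 *: ((f : R[i]^o -> R[i]^o) (d + z) - f z)) d @[d --> (0 : R[i]^o)^'] --> (l : R[i]^o).
  apply/(@cvgrPdist_lt _ (R[i]^o) (R[i]^o) ((0 : R[i]^o)^') _ _ l) => e.
  rewrite ltcE /= => /andP[/eqP e_im e0].
  have [d d0 Hd] := ccvg_epsilon ct e0.
  pose d' := Num.min d (1 - normc z).
  have d'0 : 0 < d' by rewrite lt_min d0 subr_gt0.
  apply/(@nbhs_normP _ (R[i]^o)); exists d'%:C => /=; first by rewrite ltcR.
  move=> s /=; rewrite sub0r normrN normC_normc ltcR lt_min => /andP[sd sz] s0.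
  have w1 : normc (s + z) < 1.
    by apply: le_lt_trans (normc_triangle _ _) _; rewrite -ltrBrDr.
  have E : s + z - z = s by rewrite addrK.
  rewrite Ht // E /GRing.scale /= mulrA mulVf // mul1r.
  by rewrite normC_normc ltcE /= e_im eqxx /= normcB Hd // E.
split; last exact: (cvg_lim (@norm_hausdorff _ _) H).
apply/cvg_ex; exists l.
rewrite (_ : (fun d : R[i]^o => _) =
  (fun d : R[i]^o => d^-1 *: ((f : R[i]^o -> R[i]^o) (d + z) - f z))); first exact: H.
by apply/funext => d; rewrite /= /GRing.scale /= mulr1.
Qed.

End Differentiation.

(** * The Bohr inequality *)

Section MainInequality.
Variable R : realType.
Implicit Types (u v a b : nat -> R[i]) (z w l : R[i]) (f g h : R[i] -> R[i]) (x y r K : R).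

Lemma complex_root_exists w n : (0 < n)%N -> exists z, z ^+ n = w.
Proof. by move=> n0; exists (n.-root w); exact: rootCK. Qed.

Lemma normc_root_lt1 z n : (0 < n)%N -> normc (z ^+ n) < 1 -> normc z < 1.
Proof.
rewrite normcX => n0; apply: contraLR; rewrite -!leNgt => h; exact: exprn_ege1.
Qed.

Lemma unit_seriesE : @unit_series R = cons_series 1 (fun=> 0).
Proof. by apply/funext; case. Qed.

Lemma disc_series_unit : disc_series (@unit_series R).
Proof. by rewrite unit_seriesE; apply: disc_series_cons; exact: disc_series_cst0. Qed.

Lemma ev_unit z : normc z < 1 -> ev (@unit_series R) z = 1.
Proof.
move=> z1; rewrite unit_seriesE.
by rewrite ev_cons ?ev_cst0 ?mulr0 ?addr0 //; exact: disc_series_cst0.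
Qed.

(* The bound on [h z = z^m ev a (z^p)] passes to [ev a] by the maximum principle
   on circles of radius tending to [1]. *)
Lemma bounded_coefficients_ev p m a h K : (0 < p)%N -> power_series_in_disc p m a h ->
  (forall z, unit_disc z -> normc (h z) <= K) ->
  forall w, normc w < 1 -> normc (ev a w) <= K.
Proof.
move=> p0 H hK w w1; have as_ := power_series_disc p0 H.
apply: (@ler_of_scaled _ (normc w)) => //; first exact: normc_ge0.
move=> s ws s1; have s0 : 0 < s by apply: le_lt_trans ws; exact: normc_ge0.
have [r [r0 r1 rm rs]] : exists r, [/\ 0 < r, r < 1, s <= r ^+ m & s <= r].
  case: m {H} => [|m].
    by exists s; split => //; rewrite expr0 ltW.
  have [r [r0 r1 rm]] := root_exists s0 s1 (ltn0Sn m).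
  exists r; split => //; first by rewrite rm.
  by rewrite -rm exprS ler_piMr ?(ltW r0) // exprn_ile1 // ltW.
apply: le_trans (_ : r ^+ m * normc (ev a w) <= _); first by rewrite ler_wpM2r ?normc_ge0.
have rm0 : 0 < r ^+ m by rewrite exprn_gt0.
rewrite mulrC -ler_pdivlMr // -[leRHS]mulr1 -normc_1 -(ev_unit w1).
apply: (@maximum_principle _ a (@unit_series R) r) => //.
- exact: disc_series_unit.
- by move=> x xr; rewrite ev_unit ?oner_eq0 // (le_lt_trans xr).
- move=> x xr; rewrite ev_unit ?xr // normc_1 mulr1 ler_pdivlMr //.
  have [z zx] := complex_root_exists x p0.
  have z1 : normc z < 1 by apply: (normc_root_lt1 p0); rewrite zx xr.
  apply: le_trans (hK z z1); rewrite (power_series_ev p0 H z1) zx normcM normcX mulrC.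
  rewrite ler_wpM2r ?normc_ge0 // lerXn2r ?nnegrE ?normc_ge0 ?(ltW r0) //.
  (* As [r = |z|^p <= |z|], the factor [|z|^m] in [|h z|] is at least [r^m]. *)
  rewrite -xr -zx normcX -{2}[normc z]expr1.
  by apply: ler_wiXn2l; rewrite ?normc_ge0 ?(ltW z1).
- exact: le_trans (ltW ws) rs.
Qed.

Lemma disc_series_affine_weight p m u : disc_series u ->
  disc_series (fun k => (p * k + m)%:R * u k).
Proof.
move=> us.
have := disc_seriesD (disc_seriesZ p%:R (disc_series_weight us)) (disc_seriesZ m%:R us).
by congr disc_series; apply/funext => k; rewrite natrD natrM mulrDl mulrA.
Qed.

(** Both derivatives contain the factor [z^(m-1)], which cancels for [z != 0]; every [w] is some
    [z^p], and the origin follows by continuity. *)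
Lemma dominated_derivatives p m f h g a b : (0 < p)%N -> (0 < m)%N ->
  admissible p m f h g a b ->
  dominated (fun k => (p * k + m)%:R * b k) (fun k => (p * k + m)%:R * a k).
Proof.
move=> p0 m0 [[_ _ _ Hh Hg] d0 dn _].
have ws u (us : disc_series u) := disc_series_affine_weight p m us.
have as_ := ws _ (power_series_disc p0 Hh).
have bs := ws _ (power_series_disc p0 Hg).
have dle z : normc z < 1 -> normc (cderive g z) <= normc (cderive h z).
  move=> z1; have [->|/eqP z0] := eqVneq z 0; first by rewrite [leRHS]d0.
  exact: dn.
have off w : normc w < 1 -> w != 0 ->
    normc (ev (fun k => (p * k + m)%:R * b k) w) <= normc (ev (fun k => (p * k + m)%:R * a k) w).
  move=> w1 w0; have [z zw] := complex_root_exists w p0.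
  have z1 : normc z < 1 by apply: (normc_root_lt1 p0); rewrite zw.
  have z0 : z != 0.
    by apply: contraNneq w0 => e; rewrite -zw e expr0n gtn_eqF.
  have := dle z z1.
  rewrite (has_deriv_cderive z1 (has_deriv_power_series p0 m0 Hh z1)).2.
  rewrite (has_deriv_cderive z1 (has_deriv_power_series p0 m0 Hg z1)).2.
  by rewrite zw normcM normcM ler_pM2l // normc_gt0 expf_neq0.
move=> w w1; have [->|] := eqVneq w 0; last exact: off.
by apply: ev_dominated_at => //; rewrite normc_0.
Qed.

Lemma normc_nat n : normc (n%:R : R[i]) = n%:R.
Proof. by rewrite -[n%:R](rmorph_nat (real_complex R)) normc_real ger0_norm. Qed.

(** Rogosinski's inequality for the Schur transform of [u] over the constant 1: the numerator has
    coefficients [u k.+1], the denominator [1 - |u 0|^2] followed by [- conj (u 0) u k]. *)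
Lemma schur_l2 u : disc_series u -> dominated u (@unit_series R) ->
  contractive u -> forall n,
  \sum_(k < n) normc (u k.+1) ^+ 2 <=
     \sum_(k < n) if k == 0%N :> nat then (1 - normc (u 0%N) ^+ 2) ^+ 2
                  else normc (u 0%N) ^+ 2 * normc (u k) ^+ 2.
Proof.
move=> us uD uc n.
have u1 : normc (u 0%N) <= 1 by exact: contractive_le1.
have [ue|un] := eqVneq (normc (u 0%N)) 1.
  rewrite [leLHS]big1 => [|k _]; last first.
    have := contractive_coef uc (ltn0Sn k); rewrite ue expr1n subrr => h.
    have /eqP -> : normc (u k.+1) == 0 by rewrite eq_le h normc_ge0.
    by rewrite expr0n.
  apply: sumr_ge0 => k _.
  by case: ifP => _; [exact: sqr_ge0 | apply: mulr_ge0; exact: sqr_ge0].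
have {un} ult : normc (u 0%N) < normc (@unit_series R 0%N).
  by rewrite /unit_series eqxx mulr1n normc_1 lt_neqAle un.
have := rogosinski n (disc_series_schur_num _ us disc_series_unit)
  (disc_series_schur_den _ us disc_series_unit) (schur_step us disc_series_unit uD ult).
rewrite {1 3}/unit_series eqxx mulr1n divr1.
congr (_ <= _); apply: eq_bigr => k _; rewrite /schur_num /schur_den /unit_series.
  by rewrite /= mulr0n mulr0 addr0.
case: ifP => [/eqP ->|k0].
  rewrite mulr1n mulNr [_^*%C * _]mulrC -normc_sqr_conj.
  have -> x : 1 - x%:C = (1 - x)%:C :> R[i] by rewrite rmorphB rmorph1.
  rewrite normc_real ger0_norm //.
  by rewrite subr_ge0 exprn_ile1 // normc_ge0.
by rewrite mulr0n add0r mulNr normc_opp normcM normc_conj exprMn.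
Qed.

Lemma B_H_le p m a b r (L : R) : 0 <= r ->
  (forall n, \sum_(k < n) (normc (a k) + normc (b k)) * r ^+ (p * k + m) <= L) ->
  (B_H p m a b r <= L%:E)%E.
Proof.
move=> r0 H; apply: lime_le.
  apply: is_cvg_nneseries => k _ _; rewrite lee_fin mulr_ge0 ?exprn_ge0 //.
  by rewrite addr_ge0 // normc_ge0.
apply: nearW => n; rewrite /= sumEFin lee_fin big_mkord; exact: H.
Qed.

Lemma supnorm_bound h : bounded_in_disc h ->
  exists2 K, supnorm h = K%:E & forall z, unit_disc z -> normc (h z) <= K.
Proof.
move=> [M HM].
have d0 : unit_disc (0 : R[i]) by rewrite /unit_disc /= normc_0.
have ub z : unit_disc z -> ((normc (h z))%:E <= supnorm h)%E.
  by move=> zd; apply: ereal_sup_ubound; exists z.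
have le : (supnorm h <= M%:E)%E.
  by apply: ge_ereal_sup => _ [z zd <-]; rewrite lee_fin HM.
have fin : supnorm h \is a fin_num.
  rewrite fin_numE; apply/andP; split; apply/eqP => E.
    by have := ub 0 d0; rewrite E leeNy_eq.
  by move: le; rewrite E leye_eq.
exists (fine (supnorm h)); first by rewrite fineK.
by move=> z zd; rewrite -lee_fin fineK // ub.
Qed.

(** Cross-multiplied, this is [(p - m) (k - i) >= 0], with equality throughout for [p = m]. *)
Lemma weight_ratio_le p m i k : (m <= p)%N -> (0 < m)%N -> (i <= k)%N ->
  (p * i + m)%:R / (p * k + m)%:R <= i.+1%:R / k.+1%:R :> R.
Proof.
move=> mp m0 ik.
rewrite ler_pdivrMr ?ltr0n ?addn_gt0 ?m0 ?orbT // mulrAC ler_pdivlMr ?ltr0n //.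
rewrite -!natrM ler_nat.
rewrite -(subnKC mp) -(subnKC ik); move: (p - m)%N (k - i)%N => d e.
nia.
Qed.

Lemma coefficient_sum_le p m f h g a b (rho B : R) K n : (0 < m)%N -> (m <= p)%N -> 0 < K ->
  admissible p m f h g a b -> (forall z, unit_disc z -> normc (h z) <= K) ->
  0 <= rho -> rho <= 117 / 250 ->
  31 / 36 + 5 / 7 * (rho ^+ 2 / (1 - rho ^+ 2)) <= B ->
  (forall t : R, 2 / 3 <= t -> t <= 1 -> t + rho * (1 - t ^+ 2) / (1 - rho * t) <= B) ->
  \sum_(k < n) (normc (a k) + normc (b k)) * rho ^+ k <= 2 * B * K.
Proof.
have aux (A C D E F : R) : 0 <= A -> 0 <= D -> C <= E * F ->
    A * (C * D) <= E * (A * D * F).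
  by move=> A0 D0 CE; have := ler_wpM2l (mulr_ge0 A0 D0) CE; lra.
move=> m0 mp K0 adm hK r0 r1 B1 B2.
have p0 : (0 < p)%N by exact: leq_trans mp.
have Hh := psym_series_h (adm_sym adm).
have Hg := psym_series_g (adm_sym adm).
pose c : R[i] := (K^-1)%:C.
have nc : normc c = K^-1 by rewrite normc_real gtr0_norm // invr_gt0.
pose a' k := c * a k; pose b' k := c * b k.
have as' : disc_series a' by apply: disc_seriesZ; exact: power_series_disc Hh.
have bs' : disc_series b' by apply: disc_seriesZ; exact: power_series_disc Hg.
have aD : dominated a' (@unit_series R).
  move=> w w1; rewrite ev_unit // normc_1 evZ //; last exact: power_series_disc Hh.
  rewrite normcM nc mulrC ler_pdivrMr // mul1r.
  exact: bounded_coefficients_ev Hh hK w w1.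
have aC : contractive a'.
  apply: (quotient_contractive as' disc_series_unit aD); last exact: conv_unit.
  by rewrite /unit_series eqxx oner_eq0.
pose G k := (p * k + m)%:R * b' k; pose H k := (p * k + m)%:R * a' k.
have ws u (us : disc_series u) := disc_series_affine_weight p m us.
have Gs : disc_series G by exact: ws.
have Hs : disc_series H by exact: ws.
have GH : dominated G H.
  have GE : G = fun k => c * ((p * k + m)%:R * b k) by apply/funext => k; rewrite /G mulrCA.
  have HE : H = fun k => c * ((p * k + m)%:R * a k) by apply/funext => k; rewrite /H mulrCA.
  move=> w w1; rewrite GE HE !evZ //; [|exact: ws (power_series_disc p0 Hh)|exact: ws (power_series_disc p0 Hg)].
  by rewrite !normcM ler_wpM2l ?normc_ge0 // (dominated_derivatives p0 m0 adm).
have wpos k : 0 < (p * k + m)%:R :> R by rewrite ltr0n addn_gt0 m0 orbT.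
have key := @majorant_sum_le R (fun k => normc (a' k)) (fun k => normc (b' k)) rho B n.
have -> : \sum_(k < n) (normc (a k) + normc (b k)) * rho ^+ k =
    K * \sum_(k < n) (normc (a' k) + normc (b' k)) * rho ^+ k.
  rewrite mulr_sumr; apply: eq_bigr => k _; rewrite /a' /b' !normcM nc -mulrDr !mulrA.
  by rewrite mulfV ?mul1r // gt_eqF.
rewrite mulrC ler_wpM2r ?(ltW K0) //; apply: key => //.
- by move=> k; exact: normc_ge0.
- by move=> k; exact: normc_ge0.
- case=> [|N]; first by rewrite big_ord0.
  by rewrite -(l2_unit_series R N); apply: rogosinski => //; exact: disc_series_unit.
- by move=> k k0; exact: contractive_coef.
- exact: schur_l2.
- move=> N; rewrite -subr_le0 -sumrB.
  (* The weights decrease, so Abel summation carries the inequality from the derivative coefficients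
     [G], [H] to [b'], [a']. *)
  pose w k : R := ((p * k + m)%:R ^+ 2)^-1.
  have := @abel_sum_le0 R w (fun k => normc (G k) ^+ 2 - normc (H k) ^+ 2) _ _ _ N.
  rewrite (_ : \sum_(k < N) _ = \sum_(k < N) (normc (b' k) ^+ 2 - normc (a' k) ^+ 2)); last first.
    apply: eq_bigr => k _; rewrite /G /H /w !normcM normc_nat !exprMn -mulrBr mulrA.
    by rewrite mulVf ?mul1r // expf_neq0 // gt_eqF.
  apply.
  + by move=> k; rewrite invr_ge0 exprn_ge0 // ltW.
  + move=> k; rewrite /w lef_pV2 ?posrE ?exprn_gt0 //.
    by rewrite ler_pXn2r ?nnegrE ?ler0n // ler_nat leq_add2r leq_mul2l leqnSn orbT.
  + by move=> N'; rewrite sumrB subr_le0; exact: rogosinski.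
move=> a0.
have a'0 : a' 0%N != 0 by rewrite -normc_eq0.
have H0 : H 0%N != 0.
  by rewrite mulf_neq0 // pnatr_eq0 -lt0n addn_gt0 m0 orbT.
(* These are the coefficients of [omega = G / H]. *)
have [q Hq] := conv_solve G H0.
have qC := quotient_contractive Gs Hs GH H0 Hq.
exists (fun k => normc (q k)); split.
- by move=> k; exact: normc_ge0.
- exact: contractive_le1.
- by move=> k k0; exact: contractive_coef.
move=> k; rewrite -(ler_pM2l (wpos k)) -normc_nat -normcM -/(G k) -Hq normc_nat.
apply: le_trans (normc_sum _ (fun i => q i * H (k - i)%N)) _.
rewrite mulr_sumr; apply: ler_sum => i _.
rewrite normcM /H normcM normc_nat; apply: aux; [exact: normc_ge0|exact: normc_ge0|].
have := weight_ratio_le mp m0 (leq_subr i k).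
by rewrite ler_pdivrMr // [leRHS]mulrC.
Qed.

(** [B] bounds the normalised majorant sum of each of [h] and [g], so [B_H] at [r0] is at most
    [2 B r0^m] times the norm of [h]; smaller [r] follow term by term. *)
Lemma main_inequality p m f h g a b (r0 B : R) : (0 < m)%N -> (m <= p)%N ->
  admissible p m f h g a b -> 0 <= r0 -> r0 ^+ p <= 117 / 250 ->
  31 / 36 + 5 / 7 * ((r0 ^+ p) ^+ 2 / (1 - (r0 ^+ p) ^+ 2)) <= B ->
  (forall t : R, 2 / 3 <= t -> t <= 1 ->
     t + r0 ^+ p * (1 - t ^+ 2) / (1 - r0 ^+ p * t) <= B) ->
  2 * B * r0 ^+ m <= 1 ->
  forall r, 0 <= r -> r <= r0 -> (B_H p m a b r <= maxe (supnorm h) (supnorm g))%E.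
Proof.
move=> m0 mp adm r00 r01 B1 B2 B3 r rge0 rr0.
have [K -> HK] := supnorm_bound (adm_bounded adm).
have d0 : unit_disc (0 : R[i]) by rewrite /unit_disc /= normc_0.
have K0 : 0 <= K by apply: le_trans (HK 0 d0); exact: normc_ge0.
rewrite le_max; apply/orP; left.
(* Enlarging [K] to [K + e] makes the normalisation possible even when [K = 0]. *)
apply/lee_addgt0Pr => e e0; rewrite -EFinD.
have Ke : 0 < K + e by rewrite ltr_wpDl.
apply: B_H_le => // n.
have := @coefficient_sum_le p m f h g a b (r0 ^+ p) B (K + e) n m0 mp Ke adm
  (fun z zd => le_trans (HK z zd) (_ : K <= K + e)) (exprn_ge0 _ r00) r01 B1 B2.
rewrite lerDl (ltW e0) => /(_ erefl) h1.
apply: (@le_trans _ _ (r0 ^+ m * \sum_(k < n) (normc (a k) + normc (b k)) * (r0 ^+ p) ^+ k)).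
  rewrite mulr_sumr; apply: ler_sum => k _.
  rewrite mulrCA -exprM -exprD addnC ler_wpM2l ?addr_ge0 ?normc_ge0 //.
  by rewrite lerXn2r ?nnegrE.
apply: (@le_trans _ _ (r0 ^+ m * (2 * B * (K + e)))).
  by rewrite ler_wpM2l // exprn_ge0.
by rewrite mulrA ler_piMl ?(ltW Ke) // mulrC.
Qed.

End MainInequality.

(** * Extremal functions *)

Section Extremal.
Variable R : realType.
Implicit Types (a b : nat -> R[i]) (z w : R[i]) (h : R[i] -> R[i]) (x y r s t rho : R).

Lemma power_series_of_ev p m a h : (0 < p)%N -> disc_series a ->
  (forall z, normc z < 1 -> h z = z ^+ m * ev a (z ^+ p)) ->
  power_series_in_disc p m a h.
Proof.
move=> p0 as_ H z z1; rewrite H //.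
have zp1 : normc (z ^+ p) < 1 by rewrite normcX exprn_ilt1 ?normc_ge0 // -lt0n.
apply/ctendsP; have := ctendsM (ctends_cst (z ^+ m)) (evP as_ zp1).
congr (ctends _ _); apply/funext => n; rewrite /psum /series /= big_mkord mulr_sumr.
by apply: eq_bigr => k _; rewrite -exprM exprD mulrCA [z ^+ m * _]mulrC.
Qed.

Lemma B_H_eq p m a b r (L : R) :
  (fun n => \sum_(k < n) (normc (a k) + normc (b k)) * r ^+ (p * k + m)) @ \oo --> L ->
  B_H p m a b r = L%:E.
Proof.
move=> H; apply: cvg_lim => //.
rewrite (_ : (fun n => _) = EFin \o
    (fun n => \sum_(k < n) (normc (a k) + normc (b k)) * r ^+ (p * k + m))).
  by apply/fine_cvgP; split; [exact: nearW | exact: H].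
by apply/funext => n /=; rewrite sumEFin big_mkord.
Qed.

Lemma supnorm_le1 h : (forall z, normc z < 1 -> normc (h z) <= 1) -> (supnorm h <= 1)%E.
Proof. by move=> H; apply: ge_ereal_sup => _ [z zd <-]; rewrite lee_fin H. Qed.

(** The supremum norm need not be computed: it is at most 1 by hypothesis, and at least 1 because
    the inequality itself holds at [r0], where [B_H] equals 1. *)
Lemma extremal_rotation p m a h (lambda : R[i]) r0 : (0 < p)%N -> (0 < m)%N ->
  power_series_in_disc p m a h -> normc lambda = 1 ->
  (forall z, normc z < 1 -> normc (h z) <= 1) ->
  (forall f g b, admissible p m f h g a b -> (B_H p m a b r0 <= maxe (supnorm h) (supnorm g))%E) ->
  B_H p m a (fun k => lambda * a k) r0 = 1%E ->
  (forall r, r0 < r -> r < 1 -> (1 < B_H p m a (fun k => (lambda * a k)%R) r)%E) ->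
  extremal p m (fun z => h z + (lambda * h z)^*%C) h (fun z => lambda * h z) r0.
Proof.
move=> p0 m0 H l1 h1 main E gt1.
have as_ := power_series_disc p0 H.
have Hg : power_series_in_disc p m (fun k => lambda * a k) (fun z => lambda * h z).
  apply: power_series_of_ev => //; first exact: disc_seriesZ.
  move=> z z1; have zp1 : normc (z ^+ p) < 1 by rewrite normcX exprn_ilt1 ?normc_ge0 // -lt0n.
  by rewrite evZ // (power_series_ev p0 H z1) mulrCA.
have dh z (z1 : normc z < 1) := has_deriv_cderive z1 (has_deriv_power_series p0 m0 H z1).
have dg z (z1 : normc z < 1) := has_deriv_cderive z1 (has_deriv_power_series p0 m0 Hg z1).
have dE z : normc z < 1 -> normc (cderive (fun z => lambda * h z) z) = normc (cderive h z).
  move=> z1; rewrite (dh z z1).2 (dg z z1).2.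
  have zp1 : normc (z ^+ p) < 1 by rewrite normcX exprn_ilt1 ?normc_ge0 // -lt0n.
  rewrite (_ : (fun k => (p * k + m)%:R * (lambda * a k)) =
    fun k => lambda * ((p * k + m)%:R * a k)); last by apply/funext => k; rewrite mulrCA.
  rewrite evZ //; first by rewrite !normcM l1 mul1r.
  exact: disc_series_affine_weight.
have adm : admissible p m (fun z => h z + (lambda * h z)^*%C) h (fun z => lambda * h z)
   a (fun k => lambda * a k).
  split; first split.
  - by [].
  - by move=> z z1; exact: (dh z z1).1.
  - by move=> z z1; exact: (dg z z1).1.
  - exact: H.
  - exact: Hg.
  - by symmetry; apply: dE; rewrite normc_0.
  - by move=> z z1 _; rewrite [leLHS](dE z z1).
  - by exists 1.
have max1 : maxe (supnorm h) (supnorm (fun z => lambda * h z)) = 1%E.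
  apply/eqP; rewrite eq_le; apply/andP; split.
    rewrite ge_max !supnorm_le1 // => z z1.
    by rewrite normcM l1 mul1r h1.
  by rewrite -E; exact: main adm.
exists a, (fun k => lambda * a k); split => //; first by rewrite E max1.
by move=> r r01 r1; rewrite max1; exact: gt1.
Qed.

Lemma B_H_monomial p m (lambda : R[i]) r : normc lambda = 1 ->
  B_H p m (@unit_series R) (fun k => lambda * unit_series k) r = (2 * r ^+ m)%:E.
Proof.
move=> l1; apply: B_H_eq; rewrite -cvg_shiftS.
rewrite (_ : (fun n => _) = fun=> 2 * r ^+ m); first exact: cvg_cst.
apply/funext => n; rewrite big_ord_recl big1 => [|i _].
  by rewrite /= muln0 add0n normcM l1 /unit_series eqxx mulr1n normc_1 mulr1 addr0.
by rewrite /unit_series /= mulr0n mulr0 normc_0 addr0 mul0r.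
Qed.

Definition blaschke_coef t : nat -> R[i] :=
  cons_series (- t%:C) (fun k => (1 - t ^+ 2)%:C * t%:C ^+ k).

Lemma disc_series_geometric t : 0 <= t -> t <= 1 -> disc_series (fun k => t%:C ^+ k).
Proof.
move=> t0 t1 x x0 x1; exists 1 => k; rewrite normcX normc_real ger0_norm //.
by rewrite mulr_ile1 ?exprn_ge0 // exprn_ile1 // ltW.
Qed.

Lemma ev_geometric t w : 0 <= t -> t <= 1 -> normc w < 1 ->
  ev (fun k => t%:C ^+ k) w * (1 - t%:C * w) = 1.
Proof.
move=> t0 t1 w1; have gs := disc_series_geometric t0 t1.
have := ev_shift gs w1; rewrite expr0.
rewrite (_ : (fun k => t%:C ^+ k.+1) = fun k => t%:C * t%:C ^+ k); last first.
  by apply/funext => k; rewrite exprS.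
by rewrite evZ // => E; rewrite mulrBr mulr1 {1}E; ring.
Qed.

Lemma blaschke_den_neq0 t w : 0 <= t -> t <= 1 -> normc w < 1 -> 1 - t%:C * w != 0.
Proof.
move=> t0 t1 w1; apply/eqP => e; have := ev_geometric t0 t1 w1.
by rewrite e mulr0 => /eqP; rewrite eq_sym oner_eq0.
Qed.

Lemma disc_series_blaschke t : 0 <= t -> t <= 1 -> disc_series (blaschke_coef t).
Proof.
by move=> t0 t1; apply: disc_series_cons; apply: disc_seriesZ; exact: disc_series_geometric.
Qed.

Lemma ev_blaschke t w : 0 <= t -> t <= 1 -> normc w < 1 ->
  ev (blaschke_coef t) w = (w - t%:C) / (1 - t%:C * w).
Proof.
move=> t0 t1 w1; have gs := disc_series_geometric t0 t1.
have d0 := blaschke_den_neq0 t0 t1 w1.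
rewrite ev_cons ?evZ //; last exact: disc_seriesZ.
have -> : ev (fun k => t%:C ^+ k) w = (1 - t%:C * w)^-1.
  by apply: (mulIf d0); rewrite ev_geometric // mulVf.
by rewrite rmorphB rmorph1 rmorphXn /=; field.
Qed.

Lemma normc_blaschke_le1 t w : 0 <= t -> t <= 1 -> normc w < 1 ->
  normc ((w - t%:C) / (1 - t%:C * w)) <= 1.
Proof.
move=> t0 t1 w1; have d0 := blaschke_den_neq0 t0 t1 w1.
rewrite normcM normcV ler_pdivrMr ?normc_gt0 // mul1r.
rewrite -(@ler_pXn2r _ 2) ?nnegrE ?normc_ge0 // -subr_ge0.
have := blaschke_identity w 1 t%:C; rewrite conjc_real mulr1 => ->.
rewrite normc_1 normc_real ger0_norm // expr1n.
by rewrite mulr_ge0 // subr_ge0 exprn_ile1 ?normc_ge0 // ltW.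
Qed.

Lemma B_H_blaschke p m (lambda : R[i]) t r : normc lambda = 1 -> 0 <= t -> t <= 1 ->
  0 <= r -> r ^+ p < 1 ->
  B_H p m (blaschke_coef t) (fun k => lambda * blaschke_coef t k) r =
    (2 * r ^+ m * (t + r ^+ p * (1 - t ^+ 2) / (1 - r ^+ p * t)))%:E.
Proof.
move=> l1 t0 t1 r0 rp1; apply: B_H_eq; rewrite -cvg_shiftS.
set rho := r ^+ p in rp1 *.
have rho0 : 0 <= rho by exact: exprn_ge0.
have c0 : 0 <= 1 - t ^+ 2 by rewrite subr_ge0 exprn_ile1.
rewrite (_ : (fun n => _) = fun n => 2 * r ^+ m * (t +
    series (geometric (rho * (1 - t ^+ 2)) (rho * t)) n)).
  apply: cvgMl_tmp; apply: cvgD; first exact: cvg_cst.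
  apply: cvg_geometric_series.
  rewrite ger0_norm ?mulr_ge0 //; apply: le_lt_trans rp1; exact: ler_piMr.
apply/funext => n; rewrite /series /= big_mkord big_ord_recl /= muln0 add0n.
rewrite normcM l1 mul1r normc_opp normc_real ger0_norm // mulrDr mulr_sumr; congr (_ + _).
  by ring.
apply: eq_bigr => k _; rewrite /bump /= add1n.
have -> : r ^+ (p * k.+1 + m) = rho * rho ^+ k * r ^+ m by rewrite exprD exprM exprS.
by rewrite !normcM l1 mul1r normcX !normc_real !ger0_norm // exprMn; ring.
Qed.

End Extremal.

(** * The radius *)

Section Radius.
Variable R : realType.
Implicit Types (x y r s t rho B : R) (m p : nat).

(** The difference of the two sides is [(1 - t) (1 - rho - 2 rho t) / (1 - rho t)], which is where
    Bohr's constant 1/3 comes from. *)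
Lemma majorant_le1 rho t : 0 <= rho -> rho <= 1 / 3 -> 0 <= t -> t <= 1 ->
  t + rho * (1 - t ^+ 2) / (1 - rho * t) <= 1.
Proof.
move=> r0 r1 t0 t1; have d0 : 0 < 1 - rho * t by nra.
rewrite -lerBrDl ler_pdivrMr //.
have : 0 <= (1 - t) * (1 - rho - 2 * (rho * t)) by rewrite mulr_ge0 //; nra.
by lra.
Qed.

Lemma small_le1 rho : 0 <= rho -> rho <= 1 / 3 ->
  31 / 36 + 5 / 7 * (rho ^+ 2 / (1 - rho ^+ 2)) <= 1.
Proof.
move=> r0 r1; have r2 : rho ^+ 2 <= 1 / 9 by nra.
have : rho ^+ 2 / (1 - rho ^+ 2) <= 1 / 8 by rewrite ler_pdivrMr; lra.
by lra.
Qed.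

(* Maximising [x + rho (1 - x^2) / (1 - rho x)] over [x]: with [y = 1 - rho x] the
   claim becomes [2 (y - s)^2 >= 0]. *)
Lemma majorant_le_max rho s t : 0 < rho -> rho < 1 -> 2 * s ^+ 2 = 1 - rho ^+ 2 ->
  0 <= t -> t <= 1 ->
  t + rho * (1 - t ^+ 2) / (1 - rho * t) <= (3 - 4 * s) / rho.
Proof.
move=> r0 r1 s2 t0 t1; have d0 : 0 < 1 - rho * t by nra.
rewrite -lerBrDl ler_pdivrMr // -(ler_pM2l r0).
have -> : rho * (((3 - 4 * s) / rho - t) * (1 - rho * t)) =
   (3 - 4 * s - rho * t) * (1 - rho * t) by field; exact: lt0r_neq0.
have := sqr_ge0 (1 - rho * t - s); nra.
Qed.

(** Equality in the square that bounds the maximum occurs at [1 - rho t = s]. *)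
Lemma majorant_max_attained rho s t : 0 < rho -> s != 0 -> 2 * s ^+ 2 = 1 - rho ^+ 2 ->
  t = (1 - s) / rho ->
  t + rho * (1 - t ^+ 2) / (1 - rho * t) = (3 - 4 * s) / rho.
Proof.
move=> r0 s0 s2 tE; have rn := lt0r_neq0 r0.
have rt : rho * t = 1 - s by rewrite tE mulrC divfK.
have -> : 1 - rho * t = s by rewrite rt subKr.
apply: (mulfI rn); rewrite mulrDr rt.
have -> : rho * (rho * (1 - t ^+ 2) / s) = (rho ^+ 2 - (rho * t) ^+ 2) / s by field.
rewrite rt [RHS]mulrC divfK //.
have -> : rho ^+ 2 = 1 - 2 * s ^+ 2 by rewrite s2 subKr.
by field.
Qed.

(** The maximum is bounded below by two sample values: [t = 1] for [rho <= 2/5], and [t = 4/5]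
    beyond. *)
Lemma small_le_max rho B : 1 / 3 <= rho -> rho <= 117 / 250 ->
  (forall t, 0 <= t -> t <= 1 -> t + rho * (1 - t ^+ 2) / (1 - rho * t) <= B) ->
  31 / 36 + 5 / 7 * (rho ^+ 2 / (1 - rho ^+ 2)) <= B.
Proof.
move=> r0 r1 H.
have d0 : 0 < 1 - rho ^+ 2 by nra.
have [r2|r2] := leP rho (2 / 5).
  apply: le_trans (H 1 ler01 (lexx _)); rewrite expr1n subrr mulr0 mul0r addr0.
  have : rho ^+ 2 / (1 - rho ^+ 2) <= 4 / 21 by rewrite ler_pdivrMr //; nra.
  by lra.
apply: le_trans (H (4 / 5) _ _); [|lra|lra].
have e0 : 0 < 1 - rho * (4 / 5) by lra.
have -> : rho * (1 - (4 / 5) ^+ 2) / (1 - rho * (4 / 5)) = 9 / 25 * (rho / (1 - rho * (4 / 5))).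
  by rewrite [RHS]mulrA; congr (_ / _); field.
(* An affine function of [rho] separates the two sides; 208/450 is the minimum point of the
   quadratic left after clearing the denominator. *)
have h1 : 9 / 10 * rho - 157 / 1000 <= 9 / 25 * (rho / (1 - rho * (4 / 5))).
  rewrite [leRHS]mulrA ler_pdivlMr //.
  have := sqr_ge0 (rho - 208 / 450); lra.
have h2 : 5 / 7 * (rho ^+ 2 / (1 - rho ^+ 2)) <= 9 / 10 * rho + 643 / 1000 - 31 / 36.
  rewrite [leLHS]mulrA ler_pdivrMr //.
  have h3 : 0 <= (rho - 2 / 5) * (117 / 250 - rho) by rewrite mulr_ge0; lra.
  have h4 : 0 <= (rho - 2 / 5) * (117 / 250 - rho) * rho by rewrite mulr_ge0 //; lra.
  lra.
lra.
Qed.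

Lemma majorant_mono rho rho' t : 0 <= rho -> rho <= rho' -> rho' < 1 -> 0 <= t -> t <= 1 ->
  t + rho * (1 - t ^+ 2) / (1 - rho * t) <= t + rho' * (1 - t ^+ 2) / (1 - rho' * t).
Proof.
move=> r0 rr r1 t0 t1.
have d0 : 0 < 1 - rho * t by nra.
have d1 : 0 < 1 - rho' * t by nra.
rewrite lerD2l ler_pdivrMr // mulrAC ler_pdivlMr //.
have : 0 <= 1 - t ^+ 2 by nra.
move=> c0; rewrite -subr_ge0.
have -> : rho' * (1 - t ^+ 2) * (1 - rho * t) - rho * (1 - t ^+ 2) * (1 - rho' * t) =
  (rho' - rho) * (1 - t ^+ 2) by ring.
by rewrite mulr_ge0 // subr_ge0.
Qed.

(** For [t = r^(p-m)], [rho = r^p] and [s = (6 - t) / 8] the equation reads [2 s^2 = 1 - rho^2], and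
    [3 - 4 s = t / 2] reduces the last claim to [t r^m = rho]. From [t <= 1] come [s >= 5/8] and
    [rho^2 <= 7/32 < (117/250)^2]; [rho >= 1/3] gives [s <= 2/3]. *)
Lemma radius_root_param p m r : (0 < m)%N -> (m <= p)%N -> 0 < r -> r < 1 ->
  1 / 3 <= r ^+ p -> radius_root p m r ->
  exists s, [/\ 5 / 8 <= s, s <= 2 / 3, 2 * s ^+ 2 = 1 - (r ^+ p) ^+ 2,
   r ^+ p <= 117 / 250 & 2 * ((3 - 4 * s) / r ^+ p) * r ^+ m = 1].
Proof.
move=> m0 mp r0 r1 r3; rewrite /radius_root.
have sq k : r ^+ (2 * k) = (r ^+ k) ^+ 2 by rewrite mulnC exprM.
rewrite !sq.
have t0 : 0 < r ^+ (p - m) by rewrite exprn_gt0.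
have t1 : r ^+ (p - m) <= 1 by rewrite exprn_ile1 // ltW.
have rho0 : 0 < r ^+ p by rewrite exprn_gt0.
have tE : r ^+ (p - m) * r ^+ m = r ^+ p by rewrite -exprD subnK.
move: (r ^+ (p - m)) (r ^+ m) (r ^+ p) t0 t1 rho0 r3 tE => t q rho t0 t1 rho0 r3 tE E.
exists ((6 - t) / 8); split; try lra.
- by nra.
- by nra.
- have -> : 2 * ((3 - 4 * ((6 - t) / 8)) / rho) * q = t * q / rho by field; exact: lt0r_neq0.
  by rewrite tE divff // lt0r_neq0.
Qed.

Lemma scaled_gt1 (A A' q q' : R) : 2 * A * q = 1 -> A <= A' -> q < q' -> 0 < q ->
  1 < 2 * A' * q'.
Proof.
move=> E AA qq q0; have A0 : 0 < A by rewrite -(pmulr_lgt0 _ q0); lra.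
have h1 : A * q < A * q' by rewrite ltr_pM2l.
have h2 : A * q' <= A' * q' by apply: ler_wpM2r => //; exact: ltW (lt_trans q0 qq).
lra.
Qed.

(** At both roots [2 r^m] times the maximal majorant equals 1, but this quantity strictly increases
    with [r]: the maximiser for [r] is still a competitor for [r']. *)
Lemma radius_root_le p m r r' s s' : 0 < r -> r < 1 -> 0 < r' -> r' < 1 ->
  1 / 3 <= r ^+ p -> r <= r' -> (0 < m)%N -> (0 < p)%N ->
  5 / 8 <= s -> s <= 2 / 3 -> 2 * s ^+ 2 = 1 - (r ^+ p) ^+ 2 ->
  2 * ((3 - 4 * s) / r ^+ p) * r ^+ m = 1 ->
  2 * s' ^+ 2 = 1 - (r' ^+ p) ^+ 2 ->
  2 * ((3 - 4 * s') / r' ^+ p) * r' ^+ m = 1 ->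
  r' <= r.
Proof.
move=> r0 r1 r'0 r'1 r3 rr m0 p0 s5 s23 s2 E s'2 E'.
rewrite leNgt; apply/negP => rlt.
have rho0 : 0 < r ^+ p by rewrite exprn_gt0.
have rho'0 : 0 < r' ^+ p by rewrite exprn_gt0.
have rho'1 : r' ^+ p < 1 by rewrite exprn_ilt1 ?ltW // -lt0n.
have q0 : 0 < r ^+ m by rewrite exprn_gt0.
have qq : r ^+ m < r' ^+ m by rewrite ltr_pXn2r // ?nnegrE ?ltW.
have rhole : r ^+ p <= r' ^+ p by rewrite lerXn2r // ?nnegrE ltW.
pose t := (1 - s) / r ^+ p.
have sn0 : s != 0 by rewrite gt_eqF //; lra.
have t0 : 0 <= t by rewrite divr_ge0 ?ltW //; lra.
(* Squaring [1 - s <= rho] gives [3 s^2 <= 2 s], that is, [s <= 2/3]. *)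
have t1 : t <= 1.
  rewrite ler_pdivrMr // mul1r; move: (r ^+ p) rho0 s2 => x x0 s2; nra.
have h1 := majorant_max_attained rho0 sn0 s2 (erefl t).
have h2 := majorant_mono (ltW rho0) rhole rho'1 t0 t1.
have h3 := majorant_le_max rho'0 rho'1 s'2 t0 t1.
have : (3 - 4 * s) / r ^+ p <= (3 - 4 * s') / r' ^+ p by rewrite -h1; exact: le_trans h3.
move: ((3 - 4 * s) / r ^+ p) ((3 - 4 * s') / r' ^+ p) (r ^+ m) (r' ^+ m) E E' q0 qq.
move=> A A' q q' E E' q0 qq AA; have := scaled_gt1 E AA qq q0; lra.
Qed.

(** At [q = 3^(-1/p)] the hypothesis gives [q^m <= 1/2], so [t = q^(p-m) >= 2/3] and the polynomial
    equals [(t - 2/3) (t - 34/3) <= 0]; at 1 it is 25. A root in between has [r^p >= 1/3]. *)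
Lemma radius_root_exists p m : (0 < m)%N -> (m <= p)%N -> (2 ^ p <= 3 ^ m)%N ->
  exists r, [/\ 0 < r, r < 1, 1 / 3 <= r ^+ p & radius_root p m r].
Proof.
move=> m0 mp pm; have p0 : (0 < p)%N by exact: leq_trans mp.
have [q [q0 q1 qp]] := @root_exists R (1 / 3) p ltac:(lra) ltac:(lra) p0.
pose P : {poly R} := (- 12)%:P * 'X^(p - m) + 'X^(2 * (p - m)) + 32%:P * 'X^(2 * p) + 4%:P.
have PE x : P.[x] = - 12 * x ^+ (p - m) + x ^+ (2 * (p - m)) + 32 * x ^+ (2 * p) + 4.
  by rewrite /P !(hornerE, hornerXn).
have P1 : 0 < P.[1] by rewrite PE !expr1n; lra.
have Pq : P.[q] <= 0.
  have sq k : q ^+ (2 * k) = (q ^+ k) ^+ 2 by rewrite mulnC exprM.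
  rewrite PE !sq qp.
  have t0 : 0 < q ^+ (p - m) by rewrite exprn_gt0.
  have t1 : q ^+ (p - m) <= 1 by rewrite exprn_ile1 // ltW.
  have tE : q ^+ (p - m) * q ^+ m = 1 / 3 by rewrite -exprD subnK.
  have qm0 : 0 < q ^+ m by rewrite exprn_gt0.
  have qm : q ^+ m <= 1 / 2.
    rewrite -(@ler_pXn2r _ p) ?nnegrE ?(ltW qm0) ?divr_ge0 //.
    rewrite -exprM mulnC exprM qp !expr_div_n !expr1n !mul1r.
    by rewrite lef_pV2 ?posrE ?exprn_gt0 // -!natrX ler_nat.
  move: (q ^+ (p - m)) (q ^+ m) t0 t1 tE qm0 qm => t x t0 t1 tE x0 x1; nra.
have [x /andP[x0 x1] /rootP rx] := poly_ivt (ltW q1) (introT andP (conj Pq (ltW P1))).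
have xpos : 0 < x by exact: lt_le_trans x0.
exists x; split => //.
- rewrite lt_neqAle x1 andbT; apply/eqP => xe.
  by move: P1; rewrite -xe rx ltxx.
- by rewrite -qp; apply: lerXn2r; rewrite ?nnegrE // ltW.
- by rewrite /radius_root -PE.
Qed.

Lemma ln_ratio_lt p m : (0 < m)%N ->
  (ln 3 / ln 2 < p%:R / m%:R :> R) = (3 ^ m < 2 ^ p)%N.
Proof.
move=> m0; have l2 : 0 < ln 2 :> R by rewrite ln_gt0 // ltr1n.
rewrite ltr_pdivrMr // mulrAC ltr_pdivlMr ?ltr0n // mulr_natr mulr_natl -!lnXn //.
by rewrite ltr_ln ?posrE ?exprn_gt0 // -!natrX ltr_nat.
Qed.

End Radius.

(** The cases differ in the [B] given to [main_inequality]: 1 while [rho <= 1/3], then the maximum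
    [(3 - 4 s) / rho]. In both, the radius is where [2 B r^m = 1]. *)
Theorem corollary2 (R : realType) (m p : nat)
    (m_gt0 : (1 <= m)%N) (p_ge2 : (2 <= p)%N) :
  (ln 3 / ln 2 < p%:R / m%:R :> R ->
     (forall (f h g : R[i] -> R[i]) (a b : nat -> R[i]),
        admissible p m f h g a b ->
        forall r : R, 0 <= r -> r <= 2^-1 `^ (m%:R^-1) ->
          (B_H p m a b r <= maxe (supnorm h) (supnorm g))%E)
     /\
     (forall lambda : R[i], normc lambda = 1 ->
        extremal p m (fun z => z ^+ m + (lambda * z ^+ m)^*%C)
          (fun z => z ^+ m) (fun z => lambda * z ^+ m) (2^-1 `^ (m%:R^-1))))
  /\
  (1 <= p%:R / m%:R :> R -> p%:R / m%:R <= ln 3 / ln 2 :> R ->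
     exists2 r_pm : R, maximal_radius_root p m r_pm &
     (forall (f h g : R[i] -> R[i]) (a b : nat -> R[i]),
        admissible p m f h g a b ->
        forall r : R, 0 <= r -> r <= r_pm ->
          (B_H p m a b r <= maxe (supnorm h) (supnorm g))%E)
     /\
     (forall lambda : R[i], normc lambda = 1 ->
        extremal p m
          (fun z => extremal_h p m r_pm z + (lambda * extremal_h p m r_pm z)^*%C)
          (extremal_h p m r_pm) (fun z => lambda * extremal_h p m r_pm z) r_pm)).
Proof.
have p_gt0 : (0 < p)%N by exact: ltnW.
split.
  rewrite ln_ratio_lt // => pm.
  have mp : (m <= p)%N.
    rewrite -(@leq_exp2l 2) //; apply: ltnW; apply: leq_ltn_trans pm.
    exact: leq_exp2r.
  set r0 : R := _ `^ _.
  have r0_gt0 : 0 < r0 by rewrite powR_gt0 // invr_gt0.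
  have r0m : r0 ^+ m = 2^-1.
    rewrite -powR_mulrn ?(ltW r0_gt0) // -powRrM mulVf ?pnatr_eq0 -?lt0n //.
    by rewrite powRr1 // invr_ge0.
  (* Raised to the power [m], this is [2^-p <= 3^-m], the condition behind [log_2 3]. *)
  have rho3 : r0 ^+ p <= 1 / 3.
    rewrite -(@ler_pXn2r _ m) ?nnegrE ?exprn_ge0 ?(ltW r0_gt0) ?divr_ge0 //.
    rewrite -exprM mulnC exprM r0m exprVn expr_div_n expr1n mul1r.
    by rewrite lef_pV2 ?posrE ?exprn_gt0 // -!natrX ler_nat ltnW.
  have rho0 : 0 <= r0 ^+ p by rewrite exprn_ge0 // ltW.
  have main (f h g : R[i] -> R[i]) (a b : nat -> R[i]) : admissible p m f h g a b ->
      forall r : R, 0 <= r -> r <= r0 -> (B_H p m a b r <= maxe (supnorm h) (supnorm g))%E.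
    move=> adm; apply: (@main_inequality _ p m f h g a b r0 1) => //.
    - exact: ltW.
    - by apply: le_trans rho3 _; lra.
    - exact: small_le1.
    - by move=> t t23 t1; apply: majorant_le1 => //; lra.
    - by rewrite r0m mulr1 mulfV // pnatr_eq0.
  split=> [f h g a b adm r|lambda l1]; first exact: main adm r.
  apply: (@extremal_rotation _ p m unit_series) => //.
  - apply: power_series_of_ev => //; first exact: disc_series_unit.
    move=> z z1; rewrite ev_unit ?mulr1 // normcX exprn_ilt1 ?normc_ge0 // -lt0n //.
  - by move=> z z1; rewrite normcX exprn_ile1 ?normc_ge0 // ltW.
  - by move=> f g b adm; apply: main adm _ _ _ => //; exact: ltW.
  - by rewrite B_H_monomial // r0m mulfV // pnatr_eq0.
  move=> r r0r r1; rewrite B_H_monomial // lte_fin.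
  have : r0 ^+ m < r ^+ m.
    by rewrite ltr_pXn2r // ?nnegrE ?(ltW r0_gt0) // (le_trans (ltW r0_gt0)) // ltW.
  by rewrite r0m; lra.
move=> pm1; rewrite leNgt ln_ratio_lt // -leqNgt => pm.
have mp : (m <= p)%N by move: pm1; rewrite ler_pdivlMr ?ltr0n // mul1r ler_nat.
have [r [r0 r1 r3 rr]] := @radius_root_exists R p m m_gt0 mp pm.
have [s [s5 s23 s2 rho1 E]] := radius_root_param m_gt0 mp r0 r1 r3 rr.
have rho0 : 0 < r ^+ p by rewrite exprn_gt0.
have rho_lt1 : r ^+ p < 1 by apply: le_lt_trans rho1 _; lra.
exists r; first split => //; first by rewrite r0 r1.
  move=> r' /andP[r'0 r'1] rr'; rewrite leNgt; apply/negP => rlt.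
  (* A larger root satisfies the same lower bound, so it has the same parametrisation. *)
  have r'3 : 1 / 3 <= r' ^+ p.
    by apply: le_trans r3 _; apply: lerXn2r; rewrite ?nnegrE ltW.
  have [s' [_ _ s'2 _ E']] := radius_root_param m_gt0 mp r'0 r'1 r'3 rr'.
  have := radius_root_le r0 r1 r'0 r'1 r3 (ltW rlt) m_gt0 p_gt0 s5 s23 s2 E s'2 E'.
  by rewrite leNgt rlt.
have main (f h g : R[i] -> R[i]) (a b : nat -> R[i]) : admissible p m f h g a b ->
    forall x : R, 0 <= x -> x <= r -> (B_H p m a b x <= maxe (supnorm h) (supnorm g))%E.
  have B2 (t : R) : 0 <= t -> t <= 1 ->
      t + r ^+ p * (1 - t ^+ 2) / (1 - r ^+ p * t) <= (3 - 4 * s) / r ^+ p.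
    exact: majorant_le_max.
  move=> adm; apply: (@main_inequality _ p m f h g a b r ((3 - 4 * s) / r ^+ p)) => //.
  - exact: ltW.
  - exact: small_le_max.
  - by move=> t t23 t1; apply: B2 => //; lra.
  - by rewrite E.
split=> [f h g a b adm x|lambda l1]; first exact: main adm x.
have s0 : 0 < s by lra.
(* As [s > 0], it is the quotient of square roots in [extremal_param]. *)
pose t : R := (1 - s) / r ^+ p.
have tE : extremal_param p r = t.
  rewrite /extremal_param mulnC exprM -s2 sqrtrM // sqrtr_sqr gtr0_norm //.
  by rewrite mulrAC divff ?mul1r // sqrtr_eq0 -ltNge.
have t0 : 0 <= t by rewrite divr_ge0 ?(ltW rho0) //; lra.
have t1 : t <= 1.
  by rewrite ler_pdivrMr // mul1r; move: (r ^+ p) rho0 s2 => x x0 s2; nra.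
have attained := majorant_max_attained rho0 (lt0r_neq0 s0) s2 (erefl t).
have pow1 (z : R[i]) : normc z < 1 -> normc (z ^+ p) < 1.
  by move=> z1; rewrite normcX exprn_ilt1 ?normc_ge0 // -lt0n.
apply: (@extremal_rotation _ p m (blaschke_coef t)) => //.
- apply: power_series_of_ev => //; first exact: disc_series_blaschke.
  by move=> z z1; rewrite ev_blaschke ?pow1 // /extremal_h tE.
- move=> z z1; rewrite /extremal_h tE normcM normcX mulr_ile1 ?exprn_ge0 ?normc_ge0 //.
    by rewrite exprn_ile1 ?normc_ge0 // ltW.
  by rewrite normc_blaschke_le1 // pow1.
- by move=> f g b adm; apply: main adm _ _ _ => //; exact: ltW.
- by rewrite B_H_blaschke // ?(ltW r0) // attained mulrAC E.
move=> x rx x1; have x0 : 0 < x by exact: lt_trans rx.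
have xp1 : x ^+ p < 1 by rewrite exprn_ilt1 ?(ltW x0) // -lt0n.
rewrite B_H_blaschke // ?(ltW x0) // lte_fin.
have rhole : r ^+ p <= x ^+ p by apply: lerXn2r; rewrite ?nnegrE ltW.
(* The Blaschke factor stays that of [r]: its majorant does not decrease, and strictness comes from
   [r^m < x^m]. *)
have mono := majorant_mono (ltW rho0) rhole xp1 t0 t1.
rewrite attained in mono.
have qq : r ^+ m < x ^+ m by rewrite ltr_pXn2r // ?nnegrE ltW.
have q0 : 0 < r ^+ m by rewrite exprn_gt0.
move: (_ + _) ((3 - 4 * s) / r ^+ p) (r ^+ m) (x ^+ m) E mono qq q0.
move=> A B q q' E mono qq q0; have := scaled_gt1 E mono qq q0; lra.
Qed.
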